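(* Let $\mathcal{P}_2(\mathbb{R}^d)$ be the space of Borel probability measures on $\mathbb{R}^d$ with finite second order moment, endowed with the Wasserstein distance $W_2$ and its Borel $\sigma$-field. For $(\mu,\nu)\in(\mathcal{P}_2(\mathbb{R}^d))^2$, let $\Pi^*(\mu,\nu)$ be the set of solutions of the mass transportation problem with quadratic cost associated with $(\mu,\nu)$. Then the set-valued mapping $$\Psi:(\mathcal{P}_2(\mathbb{R}^d))^2\rightrightarrows\mathbb{R}^{2d},\qquad \Psi(\mu,\nu)=\bigcup_{\pi\in\Pi^*(\mu,\nu)}\mathrm{supp}(\pi),$$ is measurable in the sense of set-valued mappings.
   Context: For $\mu,\nu\in\mathcal{P}_2(\mathbb{R}^d)$, $W_2^2(\mu,\nu)=\inf_\pi\int_{\mathbb{R}^{2d}}|x-y|^2\pi(dx,dy)$, the infimum being over Borel probability measures $\pi$ on $\mathbb{R}^{2d}$ with first marginal $\mu$ and second marginal $\nu$; $\Pi^*(\mu,\nu)$ is the (non-empty) set of such $\pi$ attaining the infimum. $\mathrm{supp}(\pi)$ is the topological support. A set-valued mapping $S:X\rightrightarrows Y$ is a function from $X$ to the set of subsets of $Y$. For $A\subset Y$, $S^{-1}(A):=\{x\in X:S(x)\cap A\neq\emptyset\}$. If $(X,\mathcal{A})$ is a measurable space and $Y$ a topological space, $S$ is measurable if $S^{-1}(\theta)\in\mathcal{A}$ for every open $\theta\subset Y$. *)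

(* Defs.v *)
From HB Require Import structures.
From mathcomp Require Import all_boot all_order all_algebra.
From mathcomp Require Import all_classical all_reals all_analysis measurable_realfun.

Set Implicit Arguments.
Unset Strict Implicit.
Unset Printing Implicit Defensive.

Import Order.TTheory GRing.Theory Num.Theory.
Import numFieldNormedType.Exports.

Local Open Scope classical_set_scope.
Local Open Scope ring_scope.

Definition svmap (X Y : Type) := X -> set Y.

Definition svpreimage (X Y : Type) (S : svmap X Y) (A : set Y) : set X :=
  [set x | S x `&` A !=set0].

Definition svmeasurable (dX : measure_display) (X : measurableType dX)
    (Y : topologicalType) (S : svmap X Y) : Prop :=
  forall theta : set Y, open theta -> measurable (svpreimage S theta).

(** R^n with its Borel sigma-algebra. *)
Definition borel_rV (R : realType) (n : nat) :=
  g_sigma_algebraType (@open 'rV[R]_n).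

(** The squared Euclidean norm; the library norm on ['rV[R]_n] is the sup
    norm, which gives the same topology but not the same cost. *)
Definition sqnorm (R : realType) (n : nat) (x : 'rV[R]_n) : R :=
  \sum_(i < n) x 0 i ^+ 2.

Definition supp (R : realType) (n : nat) (pi : probability (borel_rV R n) R) :
    set 'rV[R]_n :=
  [set z | forall U : set 'rV[R]_n, open U -> U z -> (0 < pi U)%E].

Definition second_moment (R : realType) (n : nat)
    (mu : probability (borel_rV R n) R) : \bar R :=
  (\int[mu]_x (sqnorm (x : 'rV[R]_n))%:E)%E.

Definition P2 (R : realType) (d : nat) : Type :=
  [set mu : probability (borel_rV R d) R | (second_moment mu < +oo)%E].

Section transport.
Context {R : realType} {d : nat}.

(** A point (x, y) of R^(2d) is the row vector [row_mx x y], so the two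
    projections are [lsubmx] and [rsubmx]. *)
Definition coupling (mu nu : P2 R d) : set (probability (borel_rV R (d + d)) R) :=
  [set pi | forall A : set (borel_rV R d), measurable A ->
     pi (lsubmx @^-1` A) = (val mu) A /\ pi (rsubmx @^-1` A) = (val nu) A].

Definition cost (pi : probability (borel_rV R (d + d)) R) : \bar R :=
  (\int[pi]_z (sqnorm (lsubmx (z : 'rV[R]_(d + d)) - rsubmx z))%:E)%E.

Definition W2sq (mu nu : P2 R d) : \bar R :=
  ereal_inf [set cost pi | pi in coupling mu nu].

Definition W2 (mu nu : P2 R d) : \bar R := sqrte (W2sq mu nu).

Definition optimal_plans (mu nu : P2 R d) :
    set (probability (borel_rV R (d + d)) R) :=
  [set pi | coupling mu nu pi /\ cost pi = W2sq mu nu].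

(** Open sets of the metric topology of [W2]. *)
Definition W2_open : set (set (P2 R d)) :=
  [set U | forall mu, U mu ->
     exists2 e : R, 0 < e & [set nu | (W2 mu nu < e%:E)%E] `<=` U].

Definition Psi : svmap (P2 R d * P2 R d) 'rV[R]_(d + d) :=
  fun p => \bigcup_(pi in optimal_plans p.1 p.2) supp pi.

End transport.

Lemma measurable_sqnorm (R : realType) (n : nat) :
  measurable_fun [set: borel_rV R n]
    (fun x : borel_rV R n => sqnorm (x : 'rV[R]_n)).
Proof.
apply: measurable_sum => i; apply: measurable_funX.
apply: (measurability _ (RGenOpens.measurableE R)).
move=> _ [_ [a [b ->]] <-]; rewrite setTI; apply: sub_sigma_algebra.
have := @coord_continuous R 1 n 0 i.
by move/continuousP; apply; exact: interval_open.
Qed.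

Lemma second_moment_dirac (R : realType) (d : nat) :
  (second_moment (\d_(0%R : borel_rV R d) : probability (borel_rV R d) R) < +oo)%E.
Proof.
rewrite /second_moment integral_dirac//.
  by rewrite diracT mul1e ltry.
by apply/measurable_EFinP; exact: measurable_sqnorm.
Qed.

HB.instance Definition _ (R : realType) (d : nat) := Choice.on (P2 R d).
HB.instance Definition _ (R : realType) (d : nat) :=
  isPointed.Build (P2 R d) (SigSub (mem_set (second_moment_dirac R d :
    [set mu | (second_moment mu < +oo)%E] _))).

(** The sigma-algebra on [P2 R d] is the Borel one for [W2]; [P2 R d * P2 R d]
    then carries the product of two copies of it. *)
HB.instance Definition _ (R : realType) (d : nat) :=
  Measurable.copy (P2 R d) (g_sigma_algebraType (@W2_open R d)).

(* Main.v *)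
From HB Require Import structures.
Require Import Defs.
From mathcomp Require Import finmap.
From mathcomp Require Import all_boot all_order all_algebra.
From mathcomp Require Import all_classical all_reals all_analysis.
From mathcomp Require Import measurable_realfun ring lra.
Import Order.TTheory GRing.Theory Num.Theory.
Import numFieldNormedType.Exports.

Set Implicit Arguments.
Unset Strict Implicit.
Unset Printing Implicit Defensive.

Local Open Scope classical_set_scope.
Local Open Scope ring_scope.

(** Why the theorem is true.

    An open set U of R^(2d) is a countable union of rectangles whose sides
    come from a countable base of R^d, and an open set meets the support of a
    plan exactly when the plan charges it.  Hence the preimage of U under
    [Psi] is the countable union, over the basic rectangles inside U and over
    the integers m, of the events: some optimal plan from mu to nu gives the
    rectangle mass at least 1/(m+1) ([svpreimage_Psi]).  These events have to
    be shown measurable in (mu, nu).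

    Each of them is decided by countably many finite-dimensional conditions
    ([optimal_chargingP]).  The first N sets of the base cut R^d into finitely
    many cells.  The event holds if and only if for every N there is a matrix
    of rationals, indexed by pairs of cells, whose marginals are the masses
    that mu and nu give to the cells up to a factor 1 + 1/(N+1), whose cost is
    at most the optimal one up to a vanishing slack, and which puts enough
    mass on the rectangle.  The cost of a matrix is computed with the infimum
    of the quadratic cost over each pair of cells.

    - From a plan to matrices ([plan_approx]): round up the masses that the
      plan gives to the pairs of cells.
    - From matrices to a plan ([plan_limit]), a compactness argument: spread
      each matrix over the pairs of cells proportionally to the product of mu
      and nu ([lift_plan]) and take a limit along an ultrafilter on the
      levels N.  The limit is finitely additive and its marginals are exactly
      mu and nu.  Because mu and nu are regular, a finitely additive function
      with these marginals is countably additive on measurable rectangles, as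
      Marczewski and Ryll-Nardzewski observed ([finadd_extension]), so it
      extends to a plan.  The costs computed on cells increase to the
      quadratic cost, hence monotone convergence bounds the cost of this plan.

    The same equivalence without the rectangle describes the set where the
    optimal cost is at most r ([W2sq_leP]), so the optimal cost is a
    measurable function ([measurable_W2sq]).  The conditions therefore only
    involve measurable functions of (mu, nu), once the maps that send mu to
    mu(A), for A Borel, are known to be Borel for W2.  If A is open and
    t < mu(A), then some closed part of A lying at positive distance from the
    complement of A still has mass more than t; by the Markov inequality a
    coupling of small cost moves little of it out of A.  So the set of mu with
    t < mu(A) is open for W2 ([W2_open_mass]), and a pi-lambda argument covers
    all Borel sets ([measurable_mass]). *)

(** * Borel sets of row vectors: countable base, projections, regularity *)

Section borel_rV_topology.
Context {R : realType}.

Lemma countable_bigcup_measurable d (T : sigmaRingType d) U (D : set U)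
    (F : U -> set T) : countable [set: U] ->
  (forall i, D i -> measurable (F i)) -> measurable (\bigcup_(i in D) F i).
Proof.
move=> cU mF; rewrite bigcup_mkcond; apply: countable_bigcupT_measurable => // i.
by case: ifPn => // /set_mem; exact: mF.
Qed.

(** Continuity from above at the empty set, in the epsilon form in which all
    the approximation lemmas use it. *)
Lemma measure_nonincreasing_lt d (T : measurableType d) (mu : probability T R)
    (F : (set T)^nat) (e : R) : (forall k, measurable (F k)) ->
  (forall k, F k.+1 `<=` F k) -> \bigcap_k F k = set0 -> 0 < e ->
  exists k, (mu (F k) < e%:E)%E.
Proof.
move=> mF niF F0 e0.
have := @nonincreasing_cvg_mu _ _ _ mu F; rewrite F0 measure0 => H.
have {H} : mu \o F @ \oo --> 0%E.
  apply: H => //.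
    by rewrite (le_lt_trans (probability_le1 _ _)) ?ltry.
  by apply/nonincreasing_seqP => k; exact/subsetPset.
case/fine_cvg/(_ (ball 0 e)) => [|N _ /(_ N (leqnn N))] /=.
  exact: nbhsx_ballx.
rewrite /ball/= sub0r normrN => muN; exists N.
rewrite -[mu _]fineK ?fin_num_measure// lte_fin.
by rewrite (le_lt_trans _ muN)// ler_norm.
Qed.

Lemma open_measurable_rV n (A : set 'rV[R]_n) :
  open A -> measurable (A : set (borel_rV R n)).
Proof. exact: sub_sigma_algebra. Qed.

Lemma closed_measurable_rV n (A : set 'rV[R]_n) :
  closed A -> measurable (A : set (borel_rV R n)).
Proof.
move=> cA; rewrite -[A]setCK; apply: measurableC.
by apply: open_measurable_rV; exact: closed_openC.
Qed.

(** Balls with rational centre and radius 1/(m+1), listed through the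
    encoding of pairs (centre, m) as integers. *)
Definition rV_base n (k : nat) : set 'rV[R]_n :=
  if (unpickle k : option ('rV[rat]_n * nat)) is Some (q, m) then
    ball (map_mx ratr q : 'rV[R]_n) (m.+1%:R^-1 : R)
  else set0.

Lemma rV_base_open n k : open (@rV_base n k).
Proof.
rewrite /rV_base; case: unpickle => [[q m]|]; last exact: open0.
exact: ball_open.
Qed.

Lemma rV_baseP n (U : set 'rV[R]_n) x : open U -> U x ->
  exists2 k, rV_base k x & @rV_base n k `<=` U.
Proof.
move=> oU Ux; have /nbhs_ballP[e /= e0 eU] : nbhs x U by exact: open_nbhs_nbhs.
have [m me] : exists m : nat, m.+1%:R^-1 < e / 2.
  have e20 : 0 < e / 2 by rewrite divr_gt0.
  have := near_infty_natSinv_lt (PosNum e20).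
  by case=> m _ /(_ m (leqnn m)) /=; exists m.
have m0 : (0 : R) < m.+1%:R^-1 by rewrite invr_gt0.
rewrite /rV_base; set r : R := m.+1%:R^-1 in me m0 *.
have /choice[q qP] : forall j, exists q : rat, `|ratr q - x ord0 j| < r.
  move=> j; have [] := @rat_in_itvoo R (x ord0 j - r) (x ord0 j + r).
    lra.
  move=> q; rewrite in_itv/= => /andP[q1 q2]; exists q.
  by rewrite ltr_norml; apply/andP; split; lra.
exists (pickle (\row_j q j : 'rV[rat]_n, m)); rewrite pickleK -/r.
  by split=> // i j; rewrite !mxE /= (ord1 i); exact: qP.
apply: subset_trans eU => y [_ yb]; split=> // i j.
have := yb i j; have := qP j; rewrite !mxE /ball/= (ord1 i) distrC => h1 h2.
rewrite [x ord0 j - _](_ : _ = (x ord0 j - ratr (q j)) + (ratr (q j) - y ord0 j)); last by ring.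
apply: (le_lt_trans (ler_normD _ _)); lra.
Qed.

(** The base is countable and generates the open sets, so measurability of a
    map into R^n can be tested on it. *)
Lemma measurable_from_rV n d' (T : measurableType d') (f : T -> 'rV[R]_n) :
  (forall k, measurable (f @^-1` rV_base k)) ->
  measurable_fun setT (f : T -> borel_rV R n).
Proof.
move=> mf; apply: (@measurability _ _ T (borel_rV R n) setT f (@open 'rV[R]_n)) => //.
move=> _ [U oU <-]; rewrite setTI.
have -> : f @^-1` U = \bigcup_(k in [set k | rV_base k `<=` U]) f @^-1` rV_base k.
  apply/seteqP; split=> [x Ufx|x [k /= kU fk]]; last exact: kU.
  by have [k fk kU] := rV_baseP oU Ufx; exists k.
by apply: bigcup_measurable => k _; exact: mf.
Qed.

Lemma open_lsubmx n m (U : set 'rV[R]_n) : open U ->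
  open (lsubmx @^-1` U : set 'rV[R]_(n + m)).
Proof.
move=> oU; rewrite openE => z Uz.
have /nbhs_ballP[e /= e0 eU] : nbhs (lsubmx z) U by exact: open_nbhs_nbhs.
apply/nbhs_ballP; exists e => //= y [_ zy]; apply: eU.
by split=> // i j; rewrite !mxE; exact: zy.
Qed.

Lemma open_rsubmx n m (U : set 'rV[R]_m) : open U ->
  open (rsubmx @^-1` U : set 'rV[R]_(n + m)).
Proof.
move=> oU; rewrite openE => z Uz.
have /nbhs_ballP[e /= e0 eU] : nbhs (rsubmx z) U by exact: open_nbhs_nbhs.
apply/nbhs_ballP; exists e => //= y [_ zy]; apply: eU.
by split=> // i j; rewrite !mxE; exact: zy.
Qed.

Lemma measurable_lsubmx n m :
  measurable_fun setT (lsubmx : borel_rV R (n + m) -> borel_rV R n).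
Proof.
apply: measurable_from_rV => k.
by apply: open_measurable_rV; apply: open_lsubmx; exact: rV_base_open.
Qed.

Lemma measurable_rsubmx n m :
  measurable_fun setT (rsubmx : borel_rV R (n + m) -> borel_rV R m).
Proof.
apply: measurable_from_rV => k.
by apply: open_measurable_rV; apply: open_rsubmx; exact: rV_base_open.
Qed.

Definition split_rV n m (z : 'rV[R]_(n + m)) : 'rV[R]_n * 'rV[R]_m :=
  (lsubmx z, rsubmx z).

Definition join_rV n m (p : 'rV[R]_n * 'rV[R]_m) : 'rV[R]_(n + m) :=
  row_mx p.1 p.2.

Lemma measurable_split_rV n m : measurable_fun setT
  (@split_rV n m : borel_rV R (n + m) -> (borel_rV R n * borel_rV R m)%type).
Proof.
apply/measurable_fun_pairP; split; [exact: measurable_lsubmx|exact: measurable_rsubmx].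
Qed.

Lemma rect_baseP n m (U : set 'rV[R]_(n + m)) p : open U -> U (join_rV p) ->
  exists kl : nat * nat, (rV_base kl.1 `*` rV_base kl.2) p /\
    rV_base kl.1 `*` rV_base kl.2 `<=` @join_rV n m @^-1` U.
Proof.
case: p => x y oU Uxy.
have /nbhs_ballP[e /= e0 eU] : nbhs (row_mx x y) U by exact: open_nbhs_nbhs.
have [k xk kx] := rV_baseP (ball_open x e) (ballxx x e0).
have [l yl ly] := rV_baseP (ball_open y e) (ballxx y e0).
exists (k, l); split=> // -[x' y'] [/= /kx[_ xx'] /ly[_ yy']]; apply: eU.
split=> // i j; rewrite /join_rV /= !mxE.
by case: (fintype.split j) => ?; [exact: xx'|exact: yy'].
Qed.

(** An open set of R^(n+m) is a countable union of rectangles, hence belongs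
    to the product sigma-algebra: this is where second countability enters the
    comparison of the Borel and product structures. *)
Lemma measurable_join_rV n m : measurable_fun setT
  (@join_rV n m : (borel_rV R n * borel_rV R m)%type -> borel_rV R (n + m)).
Proof.
apply: measurable_from_rV => k.
have -> : @join_rV n m @^-1` rV_base k = \bigcup_(kl in [set kl |
    rV_base kl.1 `*` rV_base kl.2 `<=` @join_rV n m @^-1` rV_base k])
    (rV_base kl.1 `*` rV_base kl.2).
  apply/seteqP; split=> [x Ufx|x [kl /= kU fk]]; last exact: kU.
  by have [kl [fk kU]] := rect_baseP (@rV_base_open (n + m) k) Ufx; exists kl.
apply: countable_bigcup_measurable; first exact: countableP.
move=> kl _.
by apply: measurableX; apply: open_measurable_rV; exact: rV_base_open.
Qed.

Section regularity.
Variables (n : nat) (mu : probability (borel_rV R n) R).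

Definition regular_set (A : set 'rV[R]_n) := forall e : R, 0 < e ->
  exists F O : set 'rV[R]_n,
    [/\ closed F, open O, F `<=` A, A `<=` O & (mu (O `\` F) < e%:E)%E].

(** The points of O at sup-distance at least r from its complement form a
    closed set, and these sets exhaust O as r decreases to 0.  The uniform
    distance is what makes transport out of O costly in [W2_open_mass]. *)
Lemma erosion (O : set 'rV[R]_n) (e : R) : open O -> 0 < e ->
  exists F : set 'rV[R]_n, exists r : R,
    [/\ closed F, 0 < r, F `<=` O, (mu (O `\` F) < e%:E)%E &
     forall x y, F x -> ~ O y -> ~ ball y r x].
Proof.
move=> oO e0.
pose F k := ~` \bigcup_(x in ~` O) ball x (k.+1%:R^-1 : R).
have cF k : closed (F k).
  by apply: open_closedC; apply: bigcup_open => x _; exact: ball_open.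
have r0 k : 0 < k.+1%:R^-1 :> R by rewrite invr_gt0.
have FO k : F k `<=` O.
  by move=> x Fx; apply: contrapT => nOx; apply: Fx; exists x => //; exact: ballxx.
have mOF k : measurable ((O `\` F k) : set (borel_rV R n)).
  by apply: measurableD; [exact: open_measurable_rV|exact: closed_measurable_rV].
have [||||k muk] := @measure_nonincreasing_lt _ _ mu (fun k => O `\` F k) e => //.
- move=> k x [Ox nFx]; split=> // Fx; apply: nFx => -[y nOy yx]; apply: Fx.
  exists y => //; apply: le_ball yx.
  by rewrite lef_pV2 ?posrE// ler_nat.
- rewrite -subset0 => x Ax.
  have Ox : O x by have [] := Ax 0%N I.
  have /nbhs_ballP[d /= d0 dO] : nbhs x O by exact: open_nbhs_nbhs.
  have [k _ /(_ k (leqnn k)) /= kd] := near_infty_natSinv_lt (PosNum d0).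
  have [_] := Ax k I; rewrite /F /= => /contrapT[y nOy yx].
  apply: nOy; apply: dO; apply: ball_sym; apply: le_ball yx; exact: ltW.
- exists (F k), (k.+1%:R^-1); split => // x y Fx nOy yx.
  by apply: Fx; exists y.
Qed.

Lemma regular_set_open (O : set 'rV[R]_n) : open O -> regular_set O.
Proof.
move=> oO e e0; have [F [r [cF _ FO muF _]]] := erosion oO e0.
by exists F, O; split.
Qed.

Lemma regular_setC (A : set 'rV[R]_n) : regular_set A -> regular_set (~` A).
Proof.
move=> rA e e0; have [F [G [cF oO FA AO FOe]]] := rA e e0; exists (~` G), (~` F); split.
- exact: open_closedC.
- exact: closed_openC.
- exact: subsetC.
- exact: subsetC.
- suff -> : ~` F `\` ~` G = G `\` F by [].
  by rewrite setDE setCK setDE setIC.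
Qed.

(** The open sets above the pieces are joined freely, but only finitely many
    of the closed sets below may be: continuity from above pays for the
    others. *)
Lemma regular_set_bigcup (A : (set 'rV[R]_n)^nat) :
  (forall k, regular_set (A k)) -> regular_set (\bigcup_k A k).
Proof.
move=> rA e e0; have e20 : 0 < e / 2 by rewrite divr_gt0.
have /choice[f fP] : forall k, exists FO : set 'rV[R]_n * set 'rV[R]_n,
    [/\ closed FO.1, open FO.2, FO.1 `<=` A k, A k `<=` FO.2 &
      (mu (FO.2 `\` FO.1) < (e / 2 / (2 ^ k.+1)%:R)%:E)%E].
  move=> k; have [|F [G FO]] := rA k (e / 2 / (2 ^ k.+1)%:R).
    by rewrite divr_gt0// ltr0n expn_gt0.
  by exists (F, G).
pose F k := (f k).1; pose O k := (f k).2.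
have mF k : measurable (F k : set (borel_rV R n)).
  by apply: closed_measurable_rV; have [] := fP k.
have mO k : measurable (O k : set (borel_rV R n)).
  by apply: open_measurable_rV; have [] := fP k.
pose FN N := \bigcup_(k in `I_N) F k.
have cFN N : closed (FN N).
  by apply: closed_bigcup => [|k _]; [exact: finite_II|have [] := fP k].
have mFN N : measurable (FN N : set (borel_rV R n)) by exact: closed_measurable_rV.
have mUF : measurable (\bigcup_k F k : set (borel_rV R n)).
  exact: bigcupT_measurable.
have mUO : measurable (\bigcup_k O k : set (borel_rV R n)).
  exact: bigcupT_measurable.
have [||||N muN] := @measure_nonincreasing_lt _ _ mu
    (fun N => (\bigcup_k F k) `\` FN N) (e / 2) => //.
- by move=> N; exact: measurableD.
- move=> N x [Ux nN]; split=> // -[k /= kN Fk]; apply: nN; exists k => //=.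
  exact: ltn_trans kN _.
- rewrite -subset0 => x Ax; have [[k _ Fk] _] := Ax 0%N I.
  by have [_] := Ax k.+1 I; apply; exists k => //=.
exists (FN N), (\bigcup_k O k); split => //.
- by apply: bigcup_open => k _; have [] := fP k.
- by move=> x [k _ Fk]; exists k => //; have [_ _ + _ _] := fP k; exact.
- by move=> x [k _ Fk]; exists k => //; have [_ _ _ + _] := fP k; exact.
have sub : (\bigcup_k O k) `\` FN N `<=`
    (\bigcup_k (O k `\` F k)) `|` ((\bigcup_k F k) `\` FN N).
  move=> x [[k _ Ok] nF]; have [Fx|nFx] := pselect ((\bigcup_k F k) x).
    by right.
  by left; exists k => //; split => // Fk; apply: nFx; exists k.
have mD k : measurable ((O k `\` F k) : set (borel_rV R n)) by exact: measurableD.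
have mUD : measurable ((\bigcup_k (O k `\` F k)) : set (borel_rV R n)).
  exact: bigcupT_measurable.
have mUN : measurable (((\bigcup_k F k) `\` FN N) : set (borel_rV R n)).
  exact: measurableD.
apply: (@le_lt_trans _ _ (mu ((\bigcup_k (O k `\` F k)) `|` ((\bigcup_k F k) `\` FN N)))).
  by apply: le_measure; rewrite ?inE//; [exact: measurableD|exact: measurableU].
apply: (@le_lt_trans _ _ (mu (\bigcup_k (O k `\` F k)) +
    mu ((\bigcup_k F k) `\` FN N))%E); first exact: measureU2.
rewrite [e in (_ < e%:E)%E]splitr EFinD; apply: lee_ltD => //.
  by rewrite ge0_fin_numE// (le_lt_trans (probability_le1 _ _)) ?ltry.
apply: le_trans (epsilon_trick0 xpredT (ltW e20)).
apply: (@le_trans _ _ (\sum_(k <oo) mu (O k `\` F k))%E).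
  exact: measure_sigma_subadditive.
by apply: lee_nneseries => // k _; have [_ _ _ _ /ltW] := fP k.
Qed.

Lemma measurable_regular (A : set (borel_rV R n)) :
  measurable A -> regular_set A.
Proof.
move: A; apply: smallest_sub; last by move=> A /regular_set_open.
split.
- by apply: regular_set_open; exact: open0.
- by move=> A rA; rewrite setTD; exact: regular_setC.
- exact: regular_set_bigcup.
Qed.

(** Closed bounded sets of R^n are compact and the balls centred at 0 exhaust
    R^n, so compact sets do as well as the closed ones of [regular_set]. *)
Lemma inner_compact (A : set (borel_rV R n)) (e : R) : measurable A -> 0 < e ->
  exists K : set 'rV[R]_n, [/\ compact K, K `<=` A & (mu (A `\` K) < e%:E)%E].
Proof.
move=> mA e0; have e20 : 0 < e / 2 by rewrite divr_gt0.
have [F [G [cF oO FA AO FOe]]] := measurable_regular mA e20.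
pose B k := [set x : 'rV[R]_n | `|x| <= k%:R].
have cB k : closed (B k).
  have -> : B k = Num.norm @^-1` [set r : R | r <= k%:R] by [].
  by apply: preimage_closed (@closed_le R _) => x _; exact: norm_continuous.
have mF := closed_measurable_rV cF; have mO := open_measurable_rV oO.
have mB k := closed_measurable_rV (cB k).
have [||||N muN] := @measure_nonincreasing_lt _ _ mu (fun N => F `\` B N) (e / 2) => //.
- by move=> N; exact: measurableD.
- move=> N x [Fx nB]; split=> // Bx; apply: nB; apply: le_trans Bx _.
  by rewrite ler_nat.
- rewrite -subset0 => x Ax.
  have [_] := Ax (Num.bound `|x|) I; apply; rewrite /B/= ltW//.
  exact: archi_boundP.
exists (F `&` B N); split.
- apply: bounded_closed_compact; last exact: closedI.
  exists N%:R; split; first by rewrite realE ler0n.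
  by move=> M NM x [_ /le_trans]; apply; exact: ltW.
- by move=> x [/FA].
- rewrite [e in (_ < e%:E)%E]splitr EFinD.
  apply: (@le_lt_trans _ _ (mu (G `\` F) + mu (F `\` B N))%E); last exact: lteD.
  apply: le_trans (measureU2 mu _ _); last 2 first.
  - exact: measurableD.
  - exact: measurableD.
  apply: le_measure; rewrite ?inE.
  - by apply: measurableD => //; exact: measurableI.
  - by apply: measurableU; exact: measurableD.
  move=> x [Ax nFB]; have [Fx|nFx] := pselect (F x).
    by right; split=> // Bx; apply: nFB.
  by left; split=> //; exact: AO.
Qed.

Lemma outer_open (A : set (borel_rV R n)) (e : R) : measurable A -> 0 < e ->
  exists O : set 'rV[R]_n, [/\ open O, A `<=` O & (mu (O `\` A) < e%:E)%E].
Proof.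
move=> mA e0; have [F [G [cF oO FA AO FOe]]] := measurable_regular mA e0.
have mF := closed_measurable_rV cF; have mO := open_measurable_rV oO.
exists G; split => //; apply: le_lt_trans FOe; apply: le_measure; rewrite ?inE.
- exact: measurableD.
- exact: measurableD.
- by move=> x [Ox nA]; split=> // /FA.
Qed.

End regularity.

End borel_rV_topology.

(** * From finitely additive functions on rectangles to measures *)

Section rect_semiring.
Context d1 d2 (T1 : measurableType d1) (T2 : measurableType d2).

(** An alias of the product type that carries the semiring of rectangles, as
    the product type itself carries the generated sigma-algebra. *)
Definition rect_type : Type := (T1 * T2)%type.

Definition rect_set : set (set rect_type) :=
  [set A `*` B | A in measurable & B in measurable].

Lemma rect_set0 : rect_set set0.
Proof. by exists set0 => //; exists set0 => //; rewrite setX0. Qed.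

Lemma rect_setI : setI_closed rect_set.
Proof.
move=> _ _ [A mA [B mB <-]] [A' mA' [B' mB' <-]].
exists (A `&` A'); first exact: measurableI.
by exists (B `&` B'); [exact: measurableI|rewrite setXI].
Qed.

(** Removing A' x B' from A x B leaves the part over A \ A' and, over the
    common part of A and A', the part in B \ B'. *)
Lemma rect_setD : semi_setD_closed rect_set.
Proof.
move=> _ _ [A mA [B mB <-]] [A' mA' [B' mB' <-]].
pose S1 := (A `\` A') `*` B; pose S2 := (A `&` A') `*` (B `\` B').
exists [set S1; S2]; split.
- exact: finite_set2.
- move=> _ [|] ->.
  + by exists (A `\` A'); [exact: measurableD|exists B].
  + by exists (A `&` A'); [exact: measurableI|exists (B `\` B'); first exact: measurableD].
- rewrite bigcup_setU !bigcup_set1; apply/seteqP; split=> -[x y] /=.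
    move=> [[Ax By] nAB]; have [A'x|nA'x] := pselect (A' x).
      by right; split=> //=; split=> // B'y; apply: nAB.
    by left; split.
  by move=> [|] [/= [Ax A'x]]; [|move=> [By B'y]]; split=> // -[].
- move=> _ _ [|] -> [|] -> //.
  + by move=> [[x y] [[/= [_ nA'x] _] [/= [_ A'x] _]]].
  + by move=> [[x y] [[/= [_ A'x] _] [/= [_ nA'x] _]]].
Qed.

Definition rect_display : measure_display -> measure_display -> measure_display.
Proof. exact (fun d _ => d). Qed.

HB.instance Definition _ := Pointed.on rect_type.
HB.instance Definition _ := @isSemiRingOfSets.Build (rect_display d1 d2)
  rect_type rect_set rect_set0 rect_setI rect_setD.

End rect_semiring.

Section finitely_additive.
Context {R : realType} d (T : measurableType d) (L : set T -> R).
Hypothesis L_ge0 : forall S, measurable S -> 0 <= L S.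
Hypothesis LU : forall S S', measurable S -> measurable S' ->
  S `&` S' = set0 -> L (S `|` S') = L S + L S'.

Lemma finadd0 : L set0 = 0.
Proof.
have := LU measurable0 measurable0 (setI0 set0); rewrite setU0 => /eqP.
by rewrite addrC -subr_eq subrr => /eqP.
Qed.

Lemma finaddD S S' : measurable S -> measurable S' -> S `<=` S' ->
  L S' = L S + L (S' `\` S).
Proof.
move=> mS mS' SS'; rewrite -LU//; last by rewrite setDIK.
  by rewrite setDUK.
exact: measurableD.
Qed.

Lemma le_finadd S S' : measurable S -> measurable S' -> S `<=` S' -> L S <= L S'.
Proof.
move=> mS mS' SS'; rewrite (finaddD mS mS' SS') lerDl L_ge0//.
exact: measurableD.
Qed.

Lemma finaddU2 S S' : measurable S -> measurable S' -> L (S `|` S') <= L S + L S'.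
Proof.
move=> mS mS'; rewrite (@finaddD S)//; [|exact: measurableU].
rewrite lerD2l le_finadd//; first by apply: measurableD => //; exact: measurableU.
by move=> x [[]].
Qed.

Lemma finadd_bigsetU (I : eqType) (s : seq I) (F : I -> set T) :
  (forall i, measurable (F i)) ->
  L (\big[setU/set0]_(i <- s) F i) <= \sum_(i <- s) L (F i).
Proof.
move=> mF; elim: s => [|i s IH]; first by rewrite !big_nil finadd0.
rewrite !big_cons; apply: (le_trans (finaddU2 _ _)) => //.
  exact: bigsetU_measurable.
by rewrite lerD2l.
Qed.

Lemma finadd_bigsetU_ord (F : nat -> set T) n :
  (forall i, measurable (F i)) -> trivIset setT F ->
  L (\big[setU/set0]_(i < n) F i) = \sum_(i < n) L (F i).
Proof.
move=> mF tF; elim: n => [|n IH]; first by rewrite !big_ord0 finadd0.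
rewrite !big_ord_recr/= LU ?IH//; first exact: bigsetU_measurable.
rewrite -subset0 => x []; rewrite -bigcup_mkord => -[k /= kn Fk] Fn.
have := tF k n I I (ex_intro _ x (conj Fk Fn)) => kE.
by rewrite kE ltnn in kn.
Qed.

End finitely_additive.

(** A finitely additive function of total mass 1 that is countably
    subadditive on rectangles agrees on rectangles with a probability. *)
Section rect_extension.
Context {R : realType} d1 d2 (T1 : measurableType d1) (T2 : measurableType d2).
Variable L : set (T1 * T2) -> R.
Hypothesis L_ge0 : forall S, measurable S -> 0 <= L S.
Hypothesis LU : forall S S', measurable S -> measurable S' ->
  S `&` S' = set0 -> L (S `|` S') = L S + L S'.
Hypothesis LT : L setT = 1.
Hypothesis L_sub : forall A B A_ B_, measurable A -> measurable B ->
  (forall k, measurable (A_ k)) -> (forall k, measurable (B_ k)) ->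
  A `*` B `<=` \bigcup_k (A_ k `*` B_ k) ->
  ((L (A `*` B))%:E <= \sum_(k <oo) (L (A_ k `*` B_ k))%:E)%E.

(** Cut off outside the measurable sets because a content has to be
    nonnegative on all sets. *)
Definition rect_content (S : set (rect_type T1 T2)) : \bar R :=
  if `[< measurable (S : set (T1 * T2)) >] then (L S)%:E else 0%E.

Lemma rect_contentE (S : set (T1 * T2)) : measurable S ->
  rect_content S = (L S)%:E.
Proof. by move=> mS; rewrite /rect_content; case: asboolP. Qed.

Lemma rect_measurable (S : set (rect_type T1 T2)) :
  measurable S -> measurable (S : set (T1 * T2)).
Proof. by move=> [A mA [B mB <-]]; exact: measurableX. Qed.

Lemma rect_content_ge0 S : (0 <= rect_content S)%E.
Proof.
by rewrite /rect_content; case: asboolP => // mS; rewrite lee_fin L_ge0.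
Qed.

Lemma rect_content_semi_additive : measure_function.semi_additive rect_content.
Proof.
move=> F k mF tF mUF; rewrite rect_contentE; last first.
  by apply: bigsetU_measurable => i _; exact: rect_measurable.
rewrite (finadd_bigsetU_ord LU)//; last by move=> i; exact: rect_measurable.
rewrite -sumEFin; apply: eq_bigr => i _.
by rewrite rect_contentE//; exact: rect_measurable.
Qed.

HB.instance Definition _ := isContent.Build _ _ R rect_content
  rect_content_ge0 rect_content_semi_additive.

Lemma rect_content_sigma_subadditive :
  measurable_subset_sigma_subadditive rect_content.
Proof.
move=> S F mF mS SF; rewrite rect_contentE; last exact: rect_measurable.
case: mS SF => A mA [B mB <-] SF.
have /choice[A_ A_P] : forall k, exists AB : set T1 * set T2,
    [/\ measurable AB.1, measurable AB.2 & F k = AB.1 `*` AB.2].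
  by move=> k; have [A' mA' [B' mB' <-]] := mF k; exists (A', B').
apply: le_trans (L_sub (A_ := fst \o A_) (B_ := snd \o A_) mA mB _ _ _) _.
- by move=> k; have [] := A_P k.
- by move=> k; have [] := A_P k.
- by apply: subset_trans SF _; apply: subset_bigcup => k _; have [_ _ ->] := A_P k.
- apply: lee_nneseries => k _.
    by rewrite lee_fin L_ge0//; apply: measurableX; have [] := A_P k.
  rewrite rect_contentE; last exact: rect_measurable.
  by have [_ _ ->] := A_P k.
Qed.

HB.instance Definition _ := Content_SigmaSubAdditive_isMeasure.Build _ _ _
  rect_content rect_content_sigma_subadditive.

Lemma sigma_rect_measurable : @measurable _ (T1 * T2)%type =
    @measurable _ (g_sigma_algebraType (@measurable _ (rect_type T1 T2))).
Proof. by rewrite measurable_prod_measurableType. Qed.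

Definition rect_measure (S : set (T1 * T2)) : \bar R :=
  measure_extension rect_content S.

Lemma rect_measure_sigma_additive : semi_sigma_additive rect_measure.
Proof.
have := @measure_semi_sigma_additive _ _ _ (measure_extension rect_content).
rewrite /semi_sigma_additive => H F mF tF mUF.
by apply: H => // [i|]; rewrite -sigma_rect_measurable.
Qed.

HB.instance Definition _ := isMeasure.Build _ _ _ rect_measure
  (measure0 (measure_extension rect_content)) (measure_ge0 (measure_extension rect_content))
  rect_measure_sigma_additive.

Lemma rect_measureE A B : measurable A -> measurable B ->
  rect_measure (A `*` B) = (L (A `*` B))%:E.
Proof.
move=> mA mB; rewrite /rect_measure /measure_extension measurable_mu_extE/=.
  by rewrite rect_contentE//; exact: measurableX.
by exists A => //; exists B.
Qed.

Lemma rect_measureT : rect_measure setT = 1%E.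
Proof. by rewrite -setXTT rect_measureE// setXTT LT. Qed.

HB.instance Definition _ :=
  Measure_isProbability.Build _ _ _ rect_measure rect_measureT.

Lemma rect_extension : exists pi : probability (T1 * T2)%type R,
  forall A B, measurable A -> measurable B -> pi (A `*` B) = (L (A `*` B))%:E.
Proof. by exists rect_measure; exact: rect_measureE. Qed.

End rect_extension.

Lemma open_setX (U V : topologicalType) (A : set U) (B : set V) :
  open A -> open B -> open (A `*` B).
Proof.
move=> oA oB; have -> : A `*` B = (fst @^-1` A) `&` (snd @^-1` B) by [].
apply: openI; apply: open_comp => // x _; [exact: cvg_fst|exact: cvg_snd].
Qed.

(** The characterisation of compactness by open covers is stated for pointed
    topological spaces; this equips products with that joint structure. *)
HB.instance Definition _ (U V : ptopologicalType) := Topological.on (U * V)%type.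

Section extension.
Context {R : realType} (n m : nat).
Notation X := (borel_rV R n).
Notation Y := (borel_rV R m).
Variables (mu : probability X R) (nu : probability Y R).
Variable L : set (X * Y) -> R.
Hypothesis L_ge0 : forall S, measurable S -> 0 <= L S.
Hypothesis LU : forall S S', measurable S -> measurable S' ->
  S `&` S' = set0 -> L (S `|` S') = L S + L S'.
Hypothesis L1 : forall A, measurable A -> (L (A `*` setT))%:E = mu A.
Hypothesis L2 : forall B, measurable B -> (L (setT `*` B))%:E = nu B.

(** Shrinking the sides of a rectangle costs no more than the mass lost by
    the marginals: the part removed lies over a removed part of a side. *)
Lemma finadd_rectD (A A' : set X) (B B' : set Y) : measurable A -> measurable A' ->
  measurable B -> measurable B' -> A' `<=` A -> B' `<=` B ->
  ((L (A `*` B))%:E <= (L (A' `*` B'))%:E + (mu (A `\` A') + nu (B `\` B')))%E.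
Proof.
move=> mA mA' mB mB' AA' BB'.
have mD : measurable (A `\` A') by exact: measurableD.
have mD' : measurable (B `\` B') by exact: measurableD.
rewrite -L1// -L2// -!EFinD lee_fin.
have mAB : measurable (A' `*` B') by exact: measurableX.
have mAT : measurable ((A `\` A') `*` [set: Y]) by exact: measurableX.
have mBT : measurable ([set: X] `*` (B `\` B')) by exact: measurableX.
apply: (@le_trans _ _ (L ((A' `*` B') `|` (((A `\` A') `*` setT) `|` (setT `*` (B `\` B')))))).
  apply: (le_finadd L_ge0 LU); first exact: measurableX.
    by apply: measurableU => //; exact: measurableU.
  move=> [x y] [/= Ax By]; have [A'x|nA'x] := pselect (A' x); last by right; left.
  by have [B'x|nB'x] := pselect (B' y); [left|right; right].
apply: (le_trans (finaddU2 L_ge0 LU _ _)) => //; first exact: measurableU.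
by rewrite lerD2l; exact: (finaddU2 L_ge0 LU).
Qed.

(** The classical argument for intervals, with regularity of the marginals in
    place of continuity of the length: shrink the covered rectangle to a
    compact one, enlarge the covering ones to open ones, and extract a finite
    cover, for which finite additivity suffices.  Half of the error e is spent
    on the compact rectangle and half on the open ones, in each case equally
    between the two sides. *)
Lemma finadd_rect_sigma_subadditive A B A_ B_ : measurable A -> measurable B ->
  (forall k, measurable (A_ k)) -> (forall k, measurable (B_ k)) ->
  A `*` B `<=` \bigcup_k (A_ k `*` B_ k) ->
  ((L (A `*` B))%:E <= \sum_(k <oo) (L (A_ k `*` B_ k))%:E)%E.
Proof.
move=> mA mB mA_ mB_ SF.
apply/lee_addgt0Pr => e e0.
have e40 : 0 < e / 4 by rewrite divr_gt0.
have ek0 k : 0 < e / 4 / (2 ^ k.+1)%:R by rewrite divr_gt0// ltr0n expn_gt0.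
have [K [cK KA muK]] := inner_compact mu mA e40.
have [K' [cK' KB nuK]] := inner_compact nu mB e40.
have /choice[U_ U_P] k := outer_open mu (mA_ k) (ek0 k).
have /choice[V_ V_P] k := outer_open nu (mB_ k) (ek0 k).
have mK : measurable (K : set X).
  by apply: closed_measurable_rV; apply: compact_closed => //; exact: norm_hausdorff.
have mK' : measurable (K' : set Y).
  by apply: closed_measurable_rV; apply: compact_closed => //; exact: norm_hausdorff.
have mU k : measurable (U_ k : set X).
  by apply: open_measurable_rV; have [] := U_P k.
have mV k : measurable (V_ k : set Y).
  by apply: open_measurable_rV; have [] := V_P k.
have mUV k : measurable (U_ k `*` V_ k : set (X * Y)) by exact: measurableX.
have cKK : compact (K `*` K') by exact: compact_setX.
move: cKK; rewrite (@compact_cover ('rV[R]_n * 'rV[R]_m)%type) => /(_ _ setT (fun k => U_ k `*` V_ k))[].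
- by move=> k _; apply: open_setX; [have [] := U_P k|have [] := V_P k].
- move=> [x y] [/= Kx K'y]; have [|k _] := SF (x, y).
    by split; [exact: KA|exact: KB].
  move=> [/= h1 h2]; exists k => //; split => /=.
    by have [_ + _] := U_P k; exact.
  by have [_ + _] := V_P k; exact.
move=> D _; rewrite /cover bigcup_fset => KUV.
have step1 := finadd_rectD mA mK mB mK' KA KB.
have step2 k : ((L (U_ k `*` V_ k))%:E <=
  (L (A_ k `*` B_ k))%:E + (e / 4 / (2 ^ k.+1)%:R + e / 4 / (2 ^ k.+1)%:R)%:E)%E.
  have [_ AU mue] := U_P k; have [_ BV nue] := V_P k.
  apply: le_trans (finadd_rectD (mU k) (mA_ k) (mV k) (mB_ k) AU BV) _.
  by apply: leeD2l; rewrite EFinD; apply: ltW; exact: lteD.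
apply: le_trans step1 _.
rewrite (_ : e%:E = (e / 4 + e / 4)%:E + (e / 4 + e / 4)%:E)%E; last first.
  by rewrite -EFinD; congr EFin; field.
rewrite [leRHS]addeA; apply: leeD; last by rewrite EFinD; apply: ltW; exact: lteD.
have h0 : (0 <= e / 4 + e / 4) by rewrite ltW// addr_gt0.
apply: le_trans (epsilon_trick _ _ h0); last first.
  by move=> k; rewrite lee_fin L_ge0//; exact: measurableX.
have hA : ((L (K `*` K'))%:E <= \sum_(k <- D) (L (U_ k `*` V_ k))%:E)%E.
  rewrite sumEFin lee_fin.
  apply: le_trans (finadd_bigsetU L_ge0 LU D mUV).
  apply: (le_finadd L_ge0 LU) => //; first exact: measurableX.
  by apply: bigsetU_measurable.
apply: (le_trans hA).
rewrite nneseries_esum//; last first.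
  move=> k _; rewrite adde_ge0// lee_fin ?L_ge0//; first exact: measurableX.
  by rewrite divr_ge0.
rewrite esum_ge//; exists [set` D] => //; rewrite fsbig_finite//= set_fsetK.
apply: lee_sum => k _; apply: le_trans (step2 k) _.
by rewrite leeD2l// lee_fin -mulrDl.
Qed.

(** Marczewski and Ryll-Nardzewski: countable additivity is inherited from the
    marginals. *)
Lemma finadd_extension : exists pi : probability (X * Y)%type R,
  forall A B, measurable A -> measurable B -> pi (A `*` B) = (L (A `*` B))%:E.
Proof.
apply: (rect_extension L_ge0 LU); last exact: finadd_rect_sigma_subadditive.
by have := L1 measurableT; rewrite probability_setT setXTT => -[].
Qed.

End extension.

(** * Compactness: limits along an ultrafilter *)

Lemma fmap_ultra T T' (f : T -> T') (F : set_system T) :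
  UltraFilter F -> UltraFilter (f @ F).
Proof.
move=> UF; apply: Build_UltraFilter => G PG FG; apply/seteqP; split=> // A GA.
have [//|FnA] := in_ultra_setVsetC (f @^-1` A) UF.
have GnA : G (~` A) by exact: FG.
have G0 : G set0 by rewrite -(setICr A); exact: filterI.
by case: (@filter_not_empty _ G PG G0).
Qed.

Section finadd_limit.
Context {R : realType} (n m : nat).
Notation X := (borel_rV R n).
Notation Y := (borel_rV R m).
Variables (mu : probability X R) (nu : probability Y R).
Variable L : nat -> set (X * Y) -> R.
Hypothesis L_ge0 : forall N S, measurable S -> 0 <= L N S.
Hypothesis LU : forall N S S', measurable S -> measurable S' ->
  S `&` S' = set0 -> L N (S `|` S') = L N S + L N S'.
Hypothesis L1 : forall A, measurable A ->
  L N (A `*` setT) @[N --> \oo] --> fine (mu A).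
Hypothesis L2 : forall B, measurable B ->
  L N (setT `*` B) @[N --> \oo] --> fine (nu B).

(** Weak compactness of the set of plans in the only form needed: along an
    ultrafilter every bounded sequence converges, so the values of L converge
    on all measurable sets at once, and the limit inherits finite additivity
    and the marginals. *)
Lemma finadd_limit : exists (U : set_system nat) (pi : probability (X * Y)%type R),
  [/\ ProperFilter U, \oo `<=` U &
    forall A B, measurable A -> measurable B ->
      L N (A `*` B) @[N --> U] --> fine (pi (A `*` B))].
Proof.
have [U [UU ooU]] := ultraFilterLemma (eventually_filter).
(* The masses converge to 1, so they eventually stay in the compact [0, 2]. *)
have LT2 : \forall N \near U, L N setT <= 2.
  apply: ooU; have := L1 measurableT; rewrite setXTT probability_setT/= => /cvgrPdist_le.
  move=> /(_ 1 ltr01); apply: filterS => N; rewrite ler_norml => /andP[]; lra.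
have cvgL S : measurable S -> cvg (L N S @[N --> U]).
  move=> mS; have := @segment_compact R 0 2; rewrite compact_ultra.
  move=> /(_ (L N S @[N --> U])) [||p [_ Lp]].
  - exact: fmap_ultra.
  - apply: filterS LT2 => N LN2; rewrite /= in_itv/= L_ge0//=.
    by apply: le_trans LN2; apply: (le_finadd (@L_ge0 N) (@LU N)).
  - by apply/cvg_ex; exists p.
pose Lim S := lim (L N S @[N --> U]).
have Lim1 A : measurable A -> (Lim (A `*` setT))%:E = mu A.
  move=> mA; rewrite -[RHS]fineK ?fin_num_measure//; congr EFin.
  by apply: cvg_lim => //; apply: cvg_trans (L1 mA); exact: cvg_app ooU.
have Lim2 B : measurable B -> (Lim (setT `*` B))%:E = nu B.
  move=> mB; rewrite -[RHS]fineK ?fin_num_measure//; congr EFin.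
  by apply: cvg_lim => //; apply: cvg_trans (L2 mB); exact: cvg_app ooU.
have Lim0 S : measurable S -> 0 <= Lim S.
  move=> mS; apply: limr_ge; first exact: cvgL.
  by apply: nearW => N; exact: L_ge0.
have LimU S S' : measurable S -> measurable S' -> S `&` S' = set0 ->
    Lim (S `|` S') = Lim S + Lim S'.
  move=> mS mS' SS'; rewrite /Lim.
  have -> : (fun N => L N (S `|` S')) = (L ^~ S) \+ (L ^~ S').
    by apply/funext => N; exact: LU.
  by rewrite limD//; exact: cvgL.
have [pi piE] := finadd_extension Lim0 LimU Lim1 Lim2.
exists U, pi; split; [exact: ultra_proper|exact: ooU|].
move=> A B mA mB.
by rewrite piE//=; exact: (cvgL _ (measurableX mA mB)).
Qed.

End finadd_limit.

(** * Cells *)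

Section finite_code.
Context d (T : measurableType d) {R : realType} (I : finType) (q : T -> I).
Hypothesis mq : forall i, measurable (q @^-1` [set i]).

Lemma measurable_code_preimage (B : pred I) : measurable (q @^-1` [set i | B i]).
Proof.
have -> : q @^-1` [set i | B i] = \bigcup_(i in [set i | B i]) q @^-1` [set i].
  by apply/seteqP; split=> [x /= Bqx|x [i /= Bi ->]//]; exists (q x).
by apply: countable_bigcup_measurable => //; exact: countableP.
Qed.

Lemma finadd_partition (L : set T -> R) S :
  (forall S S', measurable S -> measurable S' ->
    S `&` S' = set0 -> L (S `|` S') = L S + L S') ->
  measurable S -> L S = \sum_i L (S `&` q @^-1` [set i]).
Proof.
move=> LU mS.
have H (s : seq I) : uniq s ->
    L (S `&` q @^-1` [set i | i \in s]) = \sum_(i <- s) L (S `&` q @^-1` [set i]).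
  elim: s => [_|i s IH /= /andP[si us]].
    rewrite big_nil (_ : _ `&` _ = set0) ?(finadd0 LU)//.
    by rewrite -subset0 => x [].
  rewrite big_cons -IH// -LU.
  - congr L; apply/seteqP; split=> x /=.
      by move=> [Sx]; rewrite inE => /orP[/eqP|]; [left|right].
    by move=> [[Sx ->]|[Sx xs]]; split; rewrite ?mem_head// inE xs orbT.
  - exact: measurableI.
  - by apply: measurableI => //; exact: (measurable_code_preimage (mem s)).
  - by rewrite -subset0 => x [[/= _ xi] [_]] /=; rewrite xi (negbTE si).
rewrite -big_enum /=.
rewrite -H ?enum_uniq//; congr L; apply/seteqP; split=> x /= => [Sx|[]//].
by split=> //; rewrite mem_enum.
Qed.

Lemma fine_measureU (P : probability T R) S S' : measurable S -> measurable S' ->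
  S `&` S' = set0 -> fine (P (S `|` S')) = fine (P S) + fine (P S').
Proof.
by move=> mS mS' SS'; rewrite measureU// fineD// fin_num_measure.
Qed.

Lemma fine_measure_partition (P : probability T R) S : measurable S ->
  fine (P S) = \sum_i fine (P (S `&` q @^-1` [set i])).
Proof. by move=> mS; apply: (finadd_partition (L := fine \o P)) => //; exact: fine_measureU. Qed.

Lemma integral_code (P : probability T R) (g : I -> R) : (forall i, 0 <= g i) ->
  (\int[P]_x (g (q x))%:E = (\sum_i g i * fine (P (q @^-1` [set i])))%:E)%E.
Proof.
move=> g0; transitivity (\int[P]_x (\sum_(i : I) (g i * \1_(q @^-1` [set i]) x)%:E))%E.
  apply: eq_integral => x _; rewrite sumEFin (bigD1 (q x))//= big1 ?addr0.
    by rewrite indicE mem_set//= mulr1.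
  by move=> i iqx; rewrite indicE memNset ?mulr0//= => qi; rewrite qi eqxx in iqx.
rewrite ge0_integral_sum//; last 2 first.
- move=> i; apply/measurable_EFinP; apply: measurable_funM => //.
- by move=> i x _; rewrite lee_fin mulr_ge0.
rewrite -sumEFin; apply: eq_bigr => i _.
under eq_integral do rewrite EFinM.
rewrite ge0_integralZl ?lee_fin//; last exact/measurable_EFinP.
by rewrite integral_indic// setIT EFinM fineK// fin_num_measure.
Qed.

End finite_code.

Section codes.
Context {R : realType}.

(** The cells of level N are the fibers of [code N]: points are identified
    when the first N sets of the base do not separate them.  Cells of higher
    levels refine cells of lower levels, and any open set containing x
    contains its cell at some level. *)
Definition code n N (x : 'rV[R]_n) : N.-tuple bool :=
  [tuple `[< rV_base k x >] | k < N].

Arguments code : simpl never.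

(** Since [nth true] answers [true] beyond the length of the code, the same
    formula is the restriction when [M <= N]. *)
Definition truncate N M (s : N.-tuple bool) : M.-tuple bool :=
  [tuple nth true s k | k < M].

Lemma nth_code n N (x : 'rV[R]_n) k : nth true (code N x) k = (k < N)%N ==> `[< rV_base k x >].
Proof.
case: ltnP => kN; last by rewrite nth_default ?size_tuple.
rewrite implyTb -[k]/(val (Ordinal kN)) -tnth_nth tnth_mktuple//.
Qed.

Lemma truncate_code n N M (x : 'rV[R]_n) : (M <= N)%N ->
  truncate M (code N x) = code M x.
Proof.
move=> MN; apply: eq_from_tnth => k; rewrite !tnth_mktuple nth_code.
by rewrite (leq_trans (ltn_ord k) MN).
Qed.

Lemma measurable_code n N s :
  measurable (@code n N @^-1` [set s] : set (borel_rV R n)).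
Proof.
have -> : @code n N @^-1` [set s] = \bigcap_(k in `I_N)
    (if nth true s k then rV_base k else ~` @rV_base R n k).
  apply/seteqP; split=> x /=.
    move=> <- k /= kN; rewrite nth_code kN/=.
    by case: asboolP.
  move=> H; apply: eq_from_tnth => k; rewrite tnth_mktuple (tnth_nth true).
  by have := H k (ltn_ord k); case: nth => /= Hk; apply/asboolP.
apply: bigcap_measurableType => k _.
have mk := open_measurable_rV (@rV_base_open R n k).
by case: ifP => // _; exact: measurableC.
Qed.

Definition code2 n m N (p : 'rV[R]_n * 'rV[R]_m) : N.-tuple bool * N.-tuple bool :=
  (code N p.1, code N p.2).

Lemma code2_preimage n m N ij :
  @code2 n m N @^-1` [set ij] = (code N @^-1` [set ij.1]) `*` (code N @^-1` [set ij.2]).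
Proof.
by case: ij => i j; apply/seteqP; split=> -[x y] /=; [by case=> h1 h2; split|case=> /= h1 h2; rewrite /code2 /= h1 h2].
Qed.

Lemma measurable_code2 n m N ij :
  measurable (@code2 n m N @^-1` [set ij] : set (borel_rV R n * borel_rV R m)).
Proof. by rewrite code2_preimage; apply: measurableX; exact: measurable_code. Qed.

Definition truncate2 N M (ij : N.-tuple bool * N.-tuple bool) :=
  (truncate M ij.1, truncate M ij.2).

Lemma truncate2_code n m N M (p : 'rV[R]_n * 'rV[R]_m) : (M <= N)%N ->
  truncate2 M (code2 N p) = code2 M p.
Proof. by move=> MN; rewrite /truncate2 /= !truncate_code. Qed.

Definition cell_mass n N (mu : probability (borel_rV R n) R) (i : N.-tuple bool) : R :=
  fine (mu (code N @^-1` [set i])).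

Lemma cell_mass_ge0 n N (mu : probability (borel_rV R n) R) (i : N.-tuple bool) :
  0 <= cell_mass mu i.
Proof. exact: fine_ge0. Qed.

(** The error on the marginals is multiplicative so that a cell of mass 0
    receives mass 0; the masses may then be spread over the cells by
    division.  It is one-sided because masses are rounded up. *)
Definition approx_plan n m N (mu : probability (borel_rV R n) R)
    (nu : probability (borel_rV R m) R) (p : N.-tuple bool * N.-tuple bool -> R) :=
  [/\ forall ij, 0 <= p ij,
      forall i, cell_mass mu i <= \sum_j p (i, j) <= (1 + N.+1%:R^-1) * cell_mass mu i &
      forall j, cell_mass nu j <= \sum_i p (i, j) <= (1 + N.+1%:R^-1) * cell_mass nu j].

End codes.
Arguments code : simpl never.

(** The computation of a marginal of [lift_plan] on a set A, where [al i] is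
    the mass of the part of A in cell i: summing over j replaces p by its
    marginal, which is between [mu i] and [b * mu i]. *)
Lemma marginal_bound (R : realFieldType) (I J : finType) (p : I * J -> R)
    (mu al : I -> R) (nu : J -> R) (b : R) :
  (forall ij, 0 <= p ij) -> (forall i, mu i <= \sum_j p (i, j) <= b * mu i) ->
  (forall i j, nu j = 0 -> p (i, j) = 0) -> (forall i, 0 <= al i <= mu i) ->
  \sum_i al i <= \sum_ij p ij / (mu ij.1 * nu ij.2) * (al ij.1 * nu ij.2)
    <= b * \sum_i al i.
Proof.
move=> p0 pmu pnu almu.
have -> : \sum_ij p ij / (mu ij.1 * nu ij.2) * (al ij.1 * nu ij.2) =
    \sum_i \sum_j p (i, j) / (mu i * nu j) * (al i * nu j).
  by rewrite pair_bigA; apply: eq_bigr => -[i j].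
have H i : al i <= \sum_j p (i, j) / (mu i * nu j) * (al i * nu j) <= b * al i.
  have -> : \sum_j p (i, j) / (mu i * nu j) * (al i * nu j) =
      (\sum_j p (i, j)) * (al i / mu i).
    rewrite mulr_suml; apply: eq_bigr => j _.
    have [nu0|nu0] := eqVneq (nu j) 0; first by rewrite pnu// !mul0r.
    by rewrite invfM -[al i / mu i]mulr1 -(mulVf nu0); ring.
  have /andP[al0 alm] := almu i; have /andP[p1 p2] := pmu i.
  have [mu0|mu0] := eqVneq (mu i) 0.
    have -> : al i = 0 by apply/eqP; rewrite eq_le al0 andbT -mu0.
    by rewrite mul0r !mulr0 lexx.
  have mup : 0 < mu i by rewrite lt_def mu0 (le_trans al0).
  rewrite mulrA ler_pdivlMr// ler_pdivrMr// -mulrA [al i * mu i]mulrC mulrA.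
  by rewrite !ler_wpM2r.
rewrite mulr_sumr; apply/andP; split; apply: ler_sum => i _.
  by have /andP[] := H i.
by have /andP[] := H i.
Qed.

(** * Spreading a matrix over the product measure *)

Section lift.
Context {R : realType} (n m N : nat).
Notation X := (borel_rV R n).
Notation Y := (borel_rV R m).
Notation I := (N.-tuple bool * N.-tuple bool)%type.
Variables (mu : probability X R) (nu : probability Y R).
Variable p : I -> R.
Hypothesis pP : approx_plan mu nu p.

Let P : set (X * Y) -> \bar R := (mu \x nu)%E.

(** Within each pair of cells the mass p is distributed like the product
    measure.  Division by 0 yields 0, consistently with p being 0 on null
    cells. *)
Definition lift_plan (S : set (X * Y)) : R :=
  \sum_(ij : I) p ij / (cell_mass mu ij.1 * cell_mass nu ij.2) *
    fine ((mu \x nu)%E (S `&` code2 N @^-1` [set ij])).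

Let P_fin S : measurable S -> P S \is a fin_num.
Proof.
move=> mS; rewrite ge0_fin_numE ?measure_ge0//.
apply: (@le_lt_trans _ _ (P setT)); first by apply: (@le_measure _ _ _ (product_measure1 mu nu)) => //; exact: mem_set.
have -> : P setT = (mu setT * nu setT)%E by rewrite -product_measure1E// setXTT.
by rewrite !probability_setT mule1 ltry.
Qed.

Lemma lift_plan_ge0 S : 0 <= lift_plan S.
Proof.
have [p0 _ _] := pP; apply: sumr_ge0 => ij _.
apply: mulr_ge0; last by apply: fine_ge0; exact: measure_ge0.
by rewrite divr_ge0// mulr_ge0// cell_mass_ge0.
Qed.

Lemma lift_planU S S' : measurable S -> measurable S' -> S `&` S' = set0 ->
  lift_plan (S `|` S') = lift_plan S + lift_plan S'.
Proof.
move=> mS mS' SS'; rewrite -big_split/=; apply: eq_bigr => ij _.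
rewrite -mulrDr; congr (_ * _); rewrite setIUl -fineD; last 2 first.
- by apply: P_fin; apply: measurableI => //; exact: measurable_code2.
- by apply: P_fin; apply: measurableI => //; exact: measurable_code2.
rewrite [in LHS]measureU//.
- by apply: measurableI => //; exact: measurable_code2.
- by apply: measurableI => //; exact: measurable_code2.
- by rewrite setIACA SS' set0I.
Qed.

Lemma approx_plan_eq0 i j :
  (cell_mass mu i = 0 -> p (i, j) = 0) /\ (cell_mass nu j = 0 -> p (i, j) = 0).
Proof.
have [p0 pmu pnu] := pP.
split=> m0; apply/eqP; rewrite eq_le p0 andbT.
  have := pmu i; rewrite m0 mulr0 => /andP[_]; apply: le_trans.
  by rewrite (bigD1 j)//= lerDl sumr_ge0.
have := pnu j; rewrite m0 mulr0 => /andP[_]; apply: le_trans.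
by rewrite (bigD1 i)//= lerDl sumr_ge0.
Qed.

Lemma fine_prodE A B : measurable A -> measurable B ->
  fine (P (A `*` B)) = fine (mu A) * fine (nu B).
Proof. by move=> mA mB; rewrite /P product_measure1E// fineM// fin_num_measure. Qed.

(** On unions of pairs of cells of level N, spreading changes nothing. *)
Lemma lift_plan_code (B : pred I) :
  lift_plan (code2 N @^-1` [set ij | B ij]) = \sum_(ij | B ij) p ij.
Proof.
rewrite /lift_plan [RHS]big_mkcond/=; apply: eq_bigr => -[i j] _.
case: ifPn => Bij.
  have -> : code2 N @^-1` [set ij | B ij] `&` code2 N @^-1` [set (i, j)] =
      (code N @^-1` [set i]) `*` (code N @^-1` [set j]) :> set (X * Y).
    rewrite -(code2_preimage n m (i, j)); apply/seteqP; split=> [x []//|x /= xij].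
    by split=> //=; rewrite xij.
  rewrite fine_prodE; [|exact: measurable_code..].
  rewrite -/(cell_mass mu i) -/(cell_mass nu j) /=.
  have [pmu pnu] := approx_plan_eq0 i j.
  have [m0|m0] := eqVneq (cell_mass mu i) 0; first by rewrite pmu// !mul0r.
  have [n0|n0] := eqVneq (cell_mass nu j) 0; first by rewrite pnu// !mul0r.
  by rewrite divfK// mulf_neq0.
have -> : code2 N @^-1` [set ij | B ij] `&` code2 N @^-1` [set (i, j)] =
    set0 :> set (X * Y).
  by rewrite -subset0 => x [/= Bx xij]; rewrite xij (negbTE Bij) in Bx.
by rewrite measure0 mulr0.
Qed.

Lemma fine_partition k (la : probability (borel_rV R k) R) (A : set (borel_rV R k)) : measurable A ->
  \sum_i fine (la (A `&` code N @^-1` [set i])) = fine (la A).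
Proof.
move=> mA; rewrite -(@fine_measure_partition _ (borel_rV R k) _ _ (@code R k N))//.
by move=> i; exact: measurable_code.
Qed.

Lemma cell_mass_bound k (la : probability (borel_rV R k) R) (A : set (borel_rV R k)) i : measurable A ->
  0 <= fine (la (A `&` code N @^-1` [set i])) <= cell_mass la i.
Proof.
move=> mA; have mi := @measurable_code R k N i.
have mAi : measurable (A `&` code N @^-1` [set i]) by exact: measurableI.
rewrite fine_ge0//= fine_le// ?fin_num_measure//.
by apply: le_measure; [exact: mem_set|exact: mem_set|exact: subIsetr].
Qed.

Lemma lift_plan_fst A : measurable A -> fine (mu A) <= lift_plan (A `*` setT)
  <= (1 + N.+1%:R^-1) * fine (mu A).
Proof.
move=> mA; have [p0 pmu pnu] := pP; rewrite -fine_partition//.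
have -> : lift_plan (A `*` setT) =
    \sum_ij p ij / (cell_mass mu ij.1 * cell_mass nu ij.2) *
      (fine (mu (A `&` code N @^-1` [set ij.1])) * cell_mass nu ij.2).
  apply: eq_bigr => ij _; congr (_ * _).
  rewrite code2_preimage -setXI setTI fine_prodE//; last exact: measurable_code.
  by apply: measurableI => //; exact: measurable_code.
apply: (marginal_bound p0 pmu) => [i j|i]; last exact: cell_mass_bound.
by have [] := approx_plan_eq0 i j.
Qed.

Lemma lift_plan_snd B : measurable B -> fine (nu B) <= lift_plan (setT `*` B)
  <= (1 + N.+1%:R^-1) * fine (nu B).
Proof.
move=> mB; have [p0 pmu pnu] := pP; rewrite -fine_partition//.
have -> : lift_plan (setT `*` B) =
    \sum_(ji : I) p (ji.2, ji.1) / (cell_mass nu ji.1 * cell_mass mu ji.2) *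
      (fine (nu (B `&` code N @^-1` [set ji.1])) * cell_mass mu ji.2).
  rewrite (reindex_inj (can_inj (@swap_pairK _ _)))/=.
  apply: eq_bigr => -[j i] _ /=; rewrite [_ * cell_mass nu _]mulrC; congr (_ * _).
  rewrite code2_preimage -setXI setTI fine_prodE//; first by rewrite mulrC.
    exact: measurable_code.
  by apply: measurableI => //; exact: measurable_code.
apply: (@marginal_bound _ _ _ (fun ji => p (ji.2, ji.1))) => //= [i j|i].
  by have [] := approx_plan_eq0 j i.
exact: cell_mass_bound.
Qed.

End lift.

(** * Plans and matrices of cell masses *)

Lemma cvg_sumr {R : realType} {T I : Type} (F : set_system T) {FF : Filter F}
    (r : seq I) (f : I -> T -> R) (l : I -> R) :
  (forall i, f i x @[x --> F] --> l i) ->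
  \sum_(i <- r) f i x @[x --> F] --> \sum_(i <- r) l i.
Proof.
move=> fl; elim: r => [|i r IH].
  by under eq_fun do rewrite big_nil; rewrite big_nil; exact: cvg_cst.
by under eq_fun do rewrite big_cons; rewrite big_cons; exact: cvgD.
Qed.

Lemma cell_mass_neq0 {R : realType} n N (mu : probability (borel_rV R n) R) i :
  @cell_mass R n N mu i != 0 -> exists x : 'rV[R]_n, code N x = i.
Proof.
move=> m0; apply: contrapT => /forallNP nx; case/eqP: m0.
rewrite /cell_mass (_ : code N @^-1` [set i] = set0) ?measure0//.
by rewrite -subset0 => x /nx.
Qed.

Section cost.
Context {R : realType} (n m : nat).
Notation X := (borel_rV R n).
Notation Y := (borel_rV R m).
Notation Z := ('rV[R]_n * 'rV[R]_m)%type.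
Variable c : Z -> R.
Hypothesis c_ge0 : forall z, 0 <= c z.
Hypothesis c_lsc : forall (z : Z) (e : R), 0 < e -> exists k l,
  (rV_base k `*` rV_base l) z /\
  (forall w, (rV_base k `*` rV_base l) w -> c z - e <= c w).

(** The largest function constant on pairs of cells of level N that is below
    the cost.  An empty pair of cells gets the value 0. *)
Definition cell_cost N (ij : N.-tuple bool * N.-tuple bool) : R :=
  inf [set c z | z in @code2 R n m N @^-1` [set ij]].

Lemma cell_cost_le N (z : Z) : cell_cost (code2 N z) <= c z.
Proof.
apply: ge_inf; last by exists z.
by exists 0 => _ [w _ <-].
Qed.

Lemma cell_cost_ge0 N ij : 0 <= @cell_cost N ij.
Proof.
rewrite /cell_cost; set E := [set _ | _ in _].
have [->|/set0P E0] := eqVneq E set0; first by rewrite inf0.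
by apply: lb_le_inf => // _ [w _ <-].
Qed.

Lemma le_cell_cost N M (z : Z) : (M <= N)%N ->
  cell_cost (code2 M z) <= cell_cost (code2 N z).
Proof.
move=> MN; apply: lb_le_inf; first by exists (c z); exists z.
move=> _ [w /= wz <-]; have -> : code2 M z = code2 M w.
  by rewrite -(truncate2_code z MN) -wz truncate2_code.
exact: cell_cost_le.
Qed.

(** Lower semicontinuity: once the level exceeds the indices of a basic
    rectangle around z on which the cost is at least c z - e, so is its
    infimum over the cell of z. *)
Lemma cell_cost_cvg (z : Z) : cell_cost (code2 N z) @[N --> \oo] --> c z.
Proof.
apply/cvgrPdist_le => e e0; have [k [l [zkl H]]] := c_lsc z e0.
exists (maxn k l).+1 => // N /=; rewrite gtn_max => /andP[kN lN].
rewrite ger0_norm ?subr_ge0 ?cell_cost_le// lerBlDr -lerBlDl.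
apply: lb_le_inf; first by exists (c z); exists z.
move=> _ [w /= wz <-]; apply: H; case: z w zkl wz => [x y] [x' y'] /= [/= xk yl].
move=> wz; have /= xx' := congr1 fst wz; have /= yy' := congr1 snd wz; split => /=.
  have := nth_code N x k; have := nth_code N x' k; rewrite xx' kN => -> /=.
  by move=> h; apply/asboolP; rewrite h; apply/asboolP.
have := nth_code N y l; have := nth_code N y' l; rewrite yy' lN => -> /=.
by move=> h; apply/asboolP; rewrite h; apply/asboolP.
Qed.

Lemma integral_cell_cost N (pi : probability (X * Y)%type R) :
  (\int[pi]_z (cell_cost (code2 N z))%:E =
  (\sum_ij cell_cost ij * fine (pi (code2 N @^-1` [set ij])))%:E)%E.
Proof.
apply: (@integral_code _ (X * Y)%type R _ (@code2 R n m N)).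
  by move=> ij; exact: measurable_code2.
by move=> ij; exact: cell_cost_ge0.
Qed.

(** The pairs of cells that make up the rectangle of indices k and l when
    both are below N.  At lower levels, where the rectangle is not yet a union
    of cells, [nth true] errs on the side of more cells, so that these always
    cover the rectangle. *)
Definition base_cells k l N (ij : N.-tuple bool * N.-tuple bool) : bool :=
  nth true ij.1 k && nth true ij.2 l.

Lemma base_cellsE k l N : (k < N)%N -> (l < N)%N ->
  rV_base k `*` rV_base l = @code2 R n m N @^-1` [set ij | base_cells k l ij].
Proof.
move=> kN lN; apply/seteqP; split=> -[x y] /=.
  by rewrite /base_cells/= !nth_code kN lN/= => -[/= h1 h2]; apply/andP; split; apply/asboolP.
rewrite /base_cells/= !nth_code kN lN/= => /andP[/asboolP h1 /asboolP h2].
by split.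
Qed.

Lemma base_cells_sub k l N :
  rV_base k `*` rV_base l `<=` @code2 R n m N @^-1` [set ij | base_cells k l ij].
Proof.
move=> -[x y] [/= h1 h2]; rewrite /base_cells/= !nth_code.
by apply/andP; split; apply/implyP => _; apply/asboolP.
Qed.

Lemma measurable_cell_cost N :
  measurable_fun [set: X * Y] (fun z : Z => (cell_cost (code2 N z))%:E).
Proof.
have mcode (B : set _) : measurable ((@code2 R n m N @^-1` B) : set (X * Y)).
  have -> : B = [set ij | `[< B ij >]].
    by apply/seteqP; split=> ij /asboolP.
  apply: (@measurable_code_preimage _ (X * Y)%type _ (@code2 R n m N)).
  by move=> ij; exact: measurable_code2.
apply/measurable_EFinP => _ B mB; rewrite setTI.
exact: (mcode (@cell_cost N @^-1` B)).
Qed.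

(** Monotone convergence turns bounds at each level into a bound for the
    cost itself. *)
Lemma integral_cell_cost_le (pi : probability (X * Y)%type R) (r : R) :
  (forall N, \int[pi]_z (cell_cost (code2 N z))%:E <= r%:E)%E ->
  (\int[pi]_z (c z)%:E <= r%:E)%E.
Proof.
move=> H.
pose f N (z : X * Y) := (cell_cost (code2 N z))%:E.
have f0 N z : [set: X * Y] z -> (0 <= f N z)%E by rewrite lee_fin cell_cost_ge0.
have fnd z : [set: X * Y] z -> {homo f ^~ z : N M / (N <= M)%N >-> (N <= M)%E}.
  by move=> _ N M NM; rewrite lee_fin; exact: le_cell_cost.
have := @cvg_monotone_convergence _ _ _ pi setT measurableT f measurable_cell_cost f0 fnd.
have -> : (fun z : X * Y => limn (f ^~ z)) = EFin \o c.
  apply/funext => z; apply/cvg_lim => //.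
  by apply: cvg_EFin; [exact: nearW|exact: cell_cost_cvg].
move=> cvgf; rewrite -(cvg_lim _ cvgf)//; apply: lime_le; last exact: nearW.
by apply/cvg_ex; eexists; exact: cvgf.
Qed.

(** Compactness.  The cost is handled at a fixed level M first: for N >= M the
    level-M cost of the spread matrix is at most its level-N cost, and the
    level-M cost is a finite combination of masses of rectangles, which
    converge; then M tends to infinity. *)
Lemma plan_limit (mu : probability X R) (nu : probability Y R) k l (a r : R)
    (s : nat -> R) (p : forall N, N.-tuple bool * N.-tuple bool -> R) :
  s @ \oo --> r ->
  (forall N, [/\ approx_plan mu nu (p N),
    \sum_ij cell_cost ij * p N ij <= s N &
    a <= \sum_(ij | base_cells k l ij) p N ij]) ->
  exists pi : probability (X * Y)%type R,
    [/\ forall A, measurable A -> pi (A `*` setT) = mu A,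
        forall B, measurable B -> pi (setT `*` B) = nu B,
        (\int[pi]_z (c z)%:E <= r%:E)%E &
        (a%:E <= pi (rV_base k `*` rV_base l))%E].
Proof.
move=> sr pP; have ap N : approx_plan mu nu (p N) by have [] := pP N.
pose L N := lift_plan mu nu (p N).
have cvg1 (x : R) : (1 + N.+1%:R^-1) * x @[N --> \oo] --> x.
  rewrite -[X in _ --> X]mul1r; apply: cvgMl; rewrite -[X in _ --> X]addr0.
  by apply: cvgD; [exact: cvg_cst|exact: cvg_harmonic].
have L1 A : measurable A -> L N (A `*` setT) @[N --> \oo] --> fine (mu A).
  move=> mA; apply: (squeeze_cvgr _ (cvg_cst _) (cvg1 _)).
  by apply: nearW => N; exact: lift_plan_fst.
have L2 B : measurable B -> L N (setT `*` B) @[N --> \oo] --> fine (nu B).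
  move=> mB; apply: (squeeze_cvgr _ (cvg_cst _) (cvg1 _)).
  by apply: nearW => N; exact: lift_plan_snd.
have [U [pi [UU ooU piL]]] := finadd_limit
  (fun N S (_ : measurable S) => lift_plan_ge0 (ap N) S)
  (fun N => @lift_planU _ _ _ _ mu nu (p N)) L1 L2.
have mbase d' j : measurable (rV_base j : set (borel_rV R d')).
  by apply: open_measurable_rV; exact: rV_base_open.
have fpi S : measurable S -> pi S = (fine (pi S))%:E.
  by move=> mS; rewrite fineK// fin_num_measure.
have cvgU (f : nat -> R) (x : R) : f @ \oo --> x -> f @ U --> x.
  by move=> fx; apply: cvg_trans fx; exact: cvg_app.
exists pi; split.
- move=> A mA; rewrite fpi; last exact: measurableX.
  rewrite -[RHS]fineK ?fin_num_measure//; congr EFin.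
  by rewrite -(cvg_lim _ (piL _ _ mA measurableT))// -(cvg_lim _ (cvgU _ _ (L1 A mA))).
- move=> B mB; rewrite fpi; last exact: measurableX.
  rewrite -[RHS]fineK ?fin_num_measure//; congr EFin.
  by rewrite -(cvg_lim _ (piL _ _ measurableT mB))// -(cvg_lim _ (cvgU _ _ (L2 B mB))).
- apply: integral_cell_cost_le => M; rewrite integral_cell_cost lee_fin.
  have cvgS : \sum_ij cell_cost ij * L N (code2 M @^-1` [set ij]) @[N --> U] -->
      \sum_ij @cell_cost M ij * fine (pi (code2 M @^-1` [set ij])).
    apply: cvg_sumr => ij; apply: cvgMr; rewrite code2_preimage.
    by apply: piL; exact: measurable_code.
  apply: (ler_cvg_to cvgS (cvgU _ _ sr)).
    apply: ooU; exists M => // N /= MN; have [_ + _] := pP N; apply: le_trans.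
    have Lcell ij : L N (code2 M @^-1` [set ij]) =
        \sum_(ij' | truncate2 M ij' == ij) p N ij'.
      rewrite -(lift_plan_code (ap N)); congr lift_plan.
      apply/seteqP; split => z /=; rewrite truncate2_code//.
        by move=> ->.
      by move/eqP.
    under eq_bigr do rewrite Lcell mulr_sumr.
    rewrite (exchange_big_dep xpredT)//=; apply: ler_sum => ij _.
    rewrite (big_pred1 (truncate2 M ij))//.
    have [p0 _ _] := ap N.
    have [->|pij] := eqVneq (p N ij) 0; first by rewrite !mulr0.
    rewrite ler_wpM2r//.
    have [i0 j0] : (exists x, @code R n N x = ij.1) /\ (exists y, @code R m N y = ij.2).
      have [pm pn] := approx_plan_eq0 (ap N) ij.1 ij.2.
      split; [apply: (@cell_mass_neq0 _ _ _ mu)|apply: (@cell_mass_neq0 _ _ _ nu)];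
          apply: contra_neq pij => m0.
        by rewrite -(pm m0) -surjective_pairing.
      by rewrite -(pn m0) -surjective_pairing.
    case: i0 j0 => [x xi] [y yj].
    have <- : code2 N (x, y) = ij by rewrite /code2 /= xi yj; case: (ij).
    by rewrite truncate2_code//; exact: le_cell_cost.
- rewrite fpi ?lee_fin; last by apply: measurableX.
  apply: (ler_cvg_to (cvg_cst a) (piL _ _ (mbase n k) (mbase m l))).
  apply: ooU; exists (maxn k l).+1 => // N /=; rewrite gtn_max => /andP[kN lN].
  have [_ _ +] := pP N; rewrite (base_cellsE kN lN).
  by rewrite -(lift_plan_code (ap N)).
Qed.


Lemma measurable_lsc_cost : measurable_fun [set: X * Y] (c : X * Y -> R).
Proof.
apply: (@measurable_fun_cvg _ _ _ _ (fun N (z : X * Y) => cell_cost (code2 N z))).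
  by move=> N; apply/measurable_EFinP; exact: measurable_cell_cost.
by move=> z _; exact: cell_cost_cvg.
Qed.

(** The masses of pairs of cells under a plan have the right marginals, and
    their cell cost is at most the cost of the plan.  Rounding each of them up
    to a rational, by a factor at most 1 + 1/(N+1), keeps mass on the
    rectangle. *)
Lemma plan_approx (pi : probability (X * Y)%type R) (mu : probability X R)
    (nu : probability Y R) k l (a r : R) N :
  (forall A, measurable A -> pi (A `*` setT) = mu A) ->
  (forall B, measurable B -> pi (setT `*` B) = nu B) ->
  (\int[pi]_z (c z)%:E <= r%:E)%E ->
  (a%:E <= pi (rV_base k `*` rV_base l))%E ->
  exists p : {ffun N.-tuple bool * N.-tuple bool -> rat},
    [/\ approx_plan mu nu (fun ij => ratr (p ij)),
    \sum_ij cell_cost ij * ratr (p ij) <= (1 + N.+1%:R^-1) * r &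
    a <= \sum_(ij | base_cells k l ij) ratr (p ij)].
Proof.
move=> pimu pinu pic pia; set b := 1 + N.+1%:R^-1.
have b1 : 1 < b by rewrite ltrDl invr_gt0.
pose w ij := fine (pi (@code2 R n m N @^-1` [set ij])).
have w0 ij : 0 <= w ij by exact: fine_ge0.
(* A null mass stays null; otherwise there is room for a rational. *)
have /choice[q qP] : forall ij, exists x : rat, w ij <= ratr x <= b * w ij.
  move=> ij; have [->|wij] := eqVneq (w ij) 0.
    by exists 0; rewrite rmorph0 mulr0 lexx.
  have wp : 0 < w ij by rewrite lt_def wij w0.
  have [|x] := @rat_in_itvoo R (w ij) (b * w ij); first by rewrite ltr_pMl.
  by rewrite in_itv/= => /andP[x1 x2]; exists x; rewrite !ltW.
have wq ij : w ij <= ratr (q ij) by have /andP[] := qP ij.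
have qw ij : ratr (q ij) <= b * w ij by have /andP[] := qP ij.
have mc2 ij := @measurable_code2 R n m N ij.
have mc k' s := @measurable_code R k' N s.
have wmu i : \sum_j w (i, j) = cell_mass mu i.
  rewrite /cell_mass -pimu//.
  rewrite (@fine_measure_partition _ (X * Y)%type R _ (code N \o snd))//=.
  - apply: eq_bigr => j _; rewrite /w code2_preimage/=; congr (fine (pi _)).
    by apply/seteqP; split => -[x y] /=; [case=> ? ?|case=> -[? _] ?].
  - move=> j; rewrite comp_preimage -[X in measurable X]setTI.
    exact: (measurable_snd measurableT _ (mc m j)).
  - by apply: measurableX => //; exact: mc.
have wnu j : \sum_i w (i, j) = cell_mass nu j.
  rewrite /cell_mass -pinu//.
  rewrite (@fine_measure_partition _ (X * Y)%type R _ (code N \o fst))//=.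
  - apply: eq_bigr => i _; rewrite /w code2_preimage/=; congr (fine (pi _)).
    by apply/seteqP; split => -[x y] /=; [case=> ? ?|case=> -[_ ?] ?].
  - move=> i; rewrite comp_preimage -[X in measurable X]setTI.
    exact: (measurable_fst measurableT _ (mc n i)).
  - by apply: measurableX => //; exact: mc.
exists [ffun ij => q ij]; split.
- split.
  + by move=> ij; rewrite ffunE; exact: le_trans (wq ij).
  + move=> i; rewrite -wmu mulr_sumr; apply/andP.
    by split; apply: ler_sum => j _; rewrite ffunE.
  + move=> j; rewrite -wnu mulr_sumr; apply/andP.
    by split; apply: ler_sum => i _; rewrite ffunE.
- apply: (@le_trans _ _ (b * \sum_ij cell_cost ij * w ij)).
    rewrite mulr_sumr; apply: ler_sum => ij _; rewrite ffunE [leRHS]mulrCA.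
    by rewrite ler_wpM2l// cell_cost_ge0.
  rewrite ler_wpM2l//; first by rewrite ltW// (lt_trans _ b1).
  rewrite -lee_fin -integral_cell_cost; apply: le_trans pic.
  apply: ge0_le_integral => //.
  + by move=> z _; rewrite lee_fin cell_cost_ge0.
  + exact: measurable_cell_cost.
  + by apply/measurable_EFinP; exact: measurable_lsc_cost.
  + by move=> z _; rewrite lee_fin cell_cost_le.
- pose B := @code2 R n m N @^-1` [set ij | base_cells k l ij].
  have mB : measurable (B : set (X * Y)).
    exact: (@measurable_code_preimage _ (X * Y)%type _ (@code2 R n m N)).
  apply: (@le_trans _ _ (fine (pi B))).
    rewrite -lee_fin fineK ?fin_num_measure//; apply: le_trans pia _.
    apply: le_measure; [apply: mem_set|exact: mem_set|exact: base_cells_sub].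
    by apply: measurableX; apply: open_measurable_rV; exact: rV_base_open.
  rewrite (@fine_measure_partition _ (X * Y)%type R _ (code2 N))//=.
  rewrite [leRHS]big_mkcond/=; apply: ler_sum => ij _; rewrite ffunE.
  case: ifPn => Bij.
    apply: le_trans (wq ij); rewrite fine_le ?fin_num_measure//.
      exact: measurableI.
    by apply: le_measure; [apply: mem_set; exact: measurableI|exact: mem_set|exact: subIsetr].
  rewrite (_ : _ `&` _ = set0) ?measure0//.
  by rewrite -subset0 => z [/= Bz zij]; rewrite /B /= zij (negbTE Bij) in Bz.
Qed.

End cost.

(** * Measurable predicates, pushforwards, supports *)

Section measurable_predicates.
Context d (T : measurableType d) {R : realType}.

Lemma measurable_const_prop (P : Prop) : measurable [set _ : T | P].
Proof.
have [p|np] := pselect P.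
  by rewrite (_ : [set _ | _] = setT)//; apply/seteqP; split.
by rewrite (_ : [set _ | _] = set0)//; apply/seteqP; split.
Qed.

Lemma measurable_forall (U : countType) (Q : U -> T -> Prop) :
  (forall u, measurable [set x | Q u x]) -> measurable [set x | forall u, Q u x].
Proof.
move=> mQ; rewrite -[X in measurable X]setCK; apply: measurableC.
rewrite (_ : ~` _ = \bigcup_(u : U) ~` [set x | Q u x]).
  by apply: countable_bigcupT_measurable => // u; exact: measurableC.
apply/seteqP; split=> [x /= /existsNP[u nQ]|x [u _ /= nQ] /(_ u)//].
by exists u.
Qed.

Lemma measurable_exists (U : countType) (Q : U -> T -> Prop) :
  (forall u, measurable [set x | Q u x]) -> measurable [set x | exists u, Q u x].
Proof.
move=> mQ; rewrite (_ : [set _ | _] = \bigcup_(u : U) [set x | Q u x]).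
  exact: countable_bigcupT_measurable.
by apply/seteqP; split=> [x [u Qu]|x [u _ Qu]]; exists u.
Qed.

Lemma measurable_and (P Q : T -> Prop) : measurable [set x | P x] ->
  measurable [set x | Q x] -> measurable [set x | P x /\ Q x].
Proof. exact: measurableI. Qed.

Lemma measurable_le_fun (f g : T -> R) : measurable_fun setT f ->
  measurable_fun setT g -> measurable [set x | f x <= g x].
Proof.
move=> mf mg; have mh := measurable_funB mg mf.
have := mh measurableT _ (measurable_itv `[0, +oo[).
rewrite setTI (_ : _ @^-1` _ = [set x | f x <= g x])//.
by apply/seteqP; split=> x /=; rewrite in_itv/= andbT subr_ge0.
Qed.

End measurable_predicates.

(** Pushing forward along a map that is only known to be measurable, with the
    change of variables formula; stated as existence so that it applies to
    functions without a bundled structure. *)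
Lemma pushforward_probability d d' (T : measurableType d) (T' : measurableType d')
    (R : realType) (P : probability T R) (f : T -> T') : measurable_fun setT f ->
  exists Q : probability T' R, (forall A, Q A = P (f @^-1` A)) /\
    forall g : T' -> \bar R, measurable_fun setT g -> (forall y, 0 <= g y)%E ->
      (\int[Q]_y g y = \int[P]_x g (f x))%E.
Proof.
move=> mf; pose X : {mfun T >-> T'} := HB.pack f (isMeasurableFun.Build _ _ _ _ f mf).
exists (distribution P X); split=> // g mg g0.
exact: (ge0_integral_distribution X mg g0).
Qed.

Section supp.
Context {R : realType} (n : nat) (pi : probability (borel_rV R n) R).

(** If W missed the support, each of its points would have a null
    neighbourhood, hence a null basic one, and W would be a countable union of
    null sets. *)
Lemma supp_meets (W : set 'rV[R]_n) : open W -> (0 < pi W)%E ->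
  exists2 z, W z & supp pi z.
Proof.
move=> oW piW; apply: contrapT => nW.
pose F k := if pi (rV_base k) == 0%E then @rV_base R n k else set0.
have mF k : measurable (F k : set (borel_rV R n)).
  by rewrite /F; case: ifP => // _; apply: open_measurable_rV; exact: rV_base_open.
have WF : W `<=` \bigcup_k F k.
  move=> z Wz; have : ~ supp pi z by move=> sz; apply: nW; exists z.
  move=> /existsNP[U /not_implyP[oU /not_implyP[Uz piU]]].
  have [k zk kU] := rV_baseP oU Uz.
  exists k => //; rewrite /F; case: eqP => // nk; exfalso; apply: piU.
  apply: (@lt_le_trans _ _ (pi (rV_base k))).
    by rewrite lt0e; apply/andP; split; [exact/eqP|exact: measure_ge0].
  apply: le_measure; [apply: mem_set|apply: mem_set|by []].
    by apply: open_measurable_rV; exact: rV_base_open.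
  exact: open_measurable_rV.
have := measure_sigma_subadditive pi mF (open_measurable_rV oW) WF.
rewrite eseries0 => [|k _ _]; first by rewrite leNgt piW.
by rewrite /F; case: eqP => [h|_]; [exact: h|exact: measure0].
Qed.

End supp.

(** * Quadratic cost and couplings as measures on the product *)

Section quadratic_cost.
Context {R : realType} (d : nat).
Notation X := (borel_rV R d).
Notation Z := ('rV[R]_d * 'rV[R]_d)%type.

Lemma sqnorm_ge0 n (x : 'rV[R]_n) : 0 <= sqnorm x.
Proof. by apply: sumr_ge0 => i _; exact: sqr_ge0. Qed.

Lemma sqr_coord_le_sqnorm n (x : 'rV[R]_n) i : x 0 i ^+ 2 <= sqnorm x.
Proof.
by rewrite /sqnorm (bigD1 i)//= lerDl sumr_ge0// => j _; exact: sqr_ge0.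
Qed.

Definition quad_cost (z : Z) : R := sqnorm (z.1 - z.2).

Lemma quad_cost_ge0 z : 0 <= quad_cost z.
Proof. exact: sqnorm_ge0. Qed.

Lemma continuous_quad_cost :
  continuous (fun z : 'rV[R]_(d + d) => quad_cost (split_rV z)).
Proof.
move=> z; rewrite /quad_cost /sqnorm.
apply: (cvg_sumr (F := nbhs z) (f := fun i (z : 'rV[R]_(d + d)) =>
  ((split_rV z).1 - (split_rV z).2) 0 i ^+ 2)) => i.
rewrite /split_rV/= (_ : (fun x => _) = (fun x : 'rV[R]_(d + d) =>
  (x 0 (lshift d i) - x 0 (rshift d i)) * (x 0 (lshift d i) - x 0 (rshift d i)))).
  rewrite expr2 !mxE; apply: cvgM; apply: cvgB; exact: coord_continuous.
by apply/funext => x; rewrite !mxE expr2.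
Qed.

Lemma join_rVK : cancel (@join_rV R d d) (@split_rV R d d).
Proof. by move=> [x y]; rewrite /split_rV /join_rV row_mxKl row_mxKr. Qed.

Lemma split_rVK : cancel (@split_rV R d d) (@join_rV R d d).
Proof. by move=> z; rewrite /split_rV /join_rV hsubmxK. Qed.

Lemma quad_cost_lsc (z : Z) (e : R) : 0 < e -> exists k l,
  (rV_base k `*` rV_base l) z /\
  (forall w, (rV_base k `*` rV_base l) w -> quad_cost z - e <= quad_cost w).
Proof.
move=> e0; pose U := (fun y : 'rV[R]_(d + d) => quad_cost (split_rV y)) @^-1`
  [set r | quad_cost z - e < r].
have oU : open U.
  by apply: open_comp (@open_gt R _) => y _; exact: continuous_quad_cost.
have Uz : U (join_rV z) by rewrite /U/= join_rVK ltrBlDr ltrDl.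
have [[k l] [zkl sub]] := rect_baseP oU Uz; exists k, l; split => // w /sub.
by rewrite /U /= join_rVK => /ltW.
Qed.

Lemma measurable_quad_cost :
  measurable_fun [set: X * X] (fun z : X * X => (quad_cost z)%:E).
Proof.
apply/measurable_EFinP.
exact: (measurable_lsc_cost quad_cost_ge0 quad_cost_lsc).
Qed.

Lemma measurable_cost_fun : measurable_fun [set: borel_rV R (d + d)]
  (fun z : borel_rV R (d + d) =>
    (sqnorm (lsubmx (z : 'rV[R]_(d + d)) - rsubmx z))%:E).
Proof.
exact: (measurableT_comp measurable_quad_cost (@measurable_split_rV R d d)).
Qed.

Definition prod_coupling (mu nu : probability X R)
    (pi : probability (X * X)%type R) :=
  (forall A, measurable A -> pi (A `*` setT) = mu A) /\
  (forall B, measurable B -> pi (setT `*` B) = nu B).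

(** [coupling_split] and [coupling_join] transport plans between R^(2d) and
    the product of two copies of R^d, where rectangles and marginals are more
    convenient, without changing the cost. *)
Lemma coupling_split (mu nu : P2 R d) pi : coupling mu nu pi ->
  exists pi' : probability (X * X)%type R, [/\ prod_coupling (val mu) (val nu) pi',
    (\int[pi']_z (quad_cost z)%:E)%E = cost pi &
    forall S, pi' S = pi (@split_rV R d d @^-1` S)].
Proof.
move=> cpi; have [Q [QE QI]] := pushforward_probability pi (@measurable_split_rV R d d).
exists Q; split => //.
- split=> A mA; rewrite QE.
    have [<- _] := cpi _ mA; congr (pi _).
    by apply/seteqP; split=> z /=; [case|].
  have [_ <-] := cpi _ mA; congr (pi _).
  by apply/seteqP; split=> z /=; [case|].
- rewrite QI//; first exact: measurable_quad_cost.
  by move=> z; rewrite lee_fin quad_cost_ge0.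
Qed.

Lemma coupling_join (mu nu : P2 R d) pi' : prod_coupling (val mu) (val nu) pi' ->
  exists pi : probability (borel_rV R (d + d)) R, [/\ coupling mu nu pi,
    cost pi = (\int[pi']_z (quad_cost z)%:E)%E &
    forall S, pi S = pi' (@join_rV R d d @^-1` S)].
Proof.
move=> [pi1 pi2].
have [Q [QE QI]] := pushforward_probability pi' (@measurable_join_rV R d d).
exists Q; split => //.
- move=> A mA; rewrite !QE -pi1// -pi2//; split; congr (pi' _).
    by apply/seteqP; split=> -[x y] /=; rewrite /join_rV row_mxKl//; case.
  by apply/seteqP; split=> -[x y] /=; rewrite /join_rV row_mxKr//; case.
- rewrite /cost QI.
  + by apply: eq_integral => -[x y] _; rewrite /join_rV row_mxKl row_mxKr.
  + exact: measurable_cost_fun.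
  + by move=> y; rewrite lee_fin sqnorm_ge0.
Qed.

Lemma second_moment_marginal (mu : P2 R d) (pi : probability (borel_rV R (d + d)) R)
    (f : borel_rV R (d + d) -> X) : measurable_fun setT f ->
  (forall A, measurable A -> pi (f @^-1` A) = val mu A) ->
  (\int[pi]_z (sqnorm (f z : 'rV[R]_d))%:E < +oo)%E.
Proof.
move=> mf fmu; have [Q [QE QI]] := pushforward_probability pi mf.
rewrite -(QI (fun x => (sqnorm (x : 'rV[R]_d))%:E)).
- rewrite (eq_measure_integral (val mu)); first exact: (set_mem (valP mu)).
  by move=> A mA _; exact: (etrans (QE A) (fmu A mA)).
- by apply/measurable_EFinP; exact: measurable_sqnorm.
- by move=> y; rewrite lee_fin sqnorm_ge0.
Qed.

(** By the inequality (a - b)^2 <= 2 (a^2 + b^2), finiteness of the second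
    moments makes every coupling of finite cost. *)
Lemma coupling_cost_fin (mu nu : P2 R d) pi : coupling mu nu pi ->
  (cost pi < +oo)%E.
Proof.
move=> cpi.
have ml := @measurable_lsubmx R d d; have mr := @measurable_rsubmx R d d.
have m1 : measurable_fun setT (fun z : borel_rV R (d + d) => (sqnorm (lsubmx z : 'rV[R]_d))%:E).
  apply/measurable_EFinP; exact: (measurableT_comp (@measurable_sqnorm R d) ml).
have m2 : measurable_fun setT (fun z : borel_rV R (d + d) => (sqnorm (rsubmx z : 'rV[R]_d))%:E).
  apply/measurable_EFinP; exact: (measurableT_comp (@measurable_sqnorm R d) mr).
have i1 := @second_moment_marginal mu pi _ ml (fun A mA => (cpi A mA).1).
have i2 := @second_moment_marginal nu pi _ mr (fun A mA => (cpi A mA).2).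
apply: (@le_lt_trans _ _ (2%:E * ((\int[pi]_z (sqnorm (lsubmx z : 'rV[R]_d))%:E) +
   (\int[pi]_z (sqnorm (rsubmx z : 'rV[R]_d))%:E)))%E); last first.
  by rewrite lte_mul_pinfty// lte_add_pinfty.
have nn n (x : 'rV[R]_n) : (0 <= (sqnorm x)%:E)%E by rewrite lee_fin sqnorm_ge0.
rewrite -ge0_integralD// -ge0_integralZl//; last 2 first.
- exact: emeasurable_funD.
- by move=> z _; exact: adde_ge0.
apply: ge0_le_integral => //.
- exact: measurable_cost_fun.
- by apply: emeasurable_funM => //; exact: emeasurable_funD.
move=> z _; rewrite -EFinD -EFinM lee_fin /sqnorm -big_split mulr_sumr.
apply: ler_sum => i _; rewrite !mxE /=.
set a := z _ _; set b := z _ _; have := sqr_ge0 (a + b); nra.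
Qed.

End quadratic_cost.

(** * Measurability on the Wasserstein space *)

Section wasserstein_borel.
Context {R : realType} (d : nat).
Notation X := (borel_rV R d).

Lemma W2sq_ge0 (mu nu : P2 R d) : (0 <= W2sq mu nu)%E.
Proof.
apply: le_ereal_inf_tmp => _ [pi _ <-]; apply: integral_ge0 => z _.
by rewrite lee_fin sqnorm_ge0.
Qed.

(** Markov inequality: mass starting in F and ending outside O travels a
    distance at least r. *)
Lemma coupling_mass_le (mu nu : P2 R d) pi (F O : set 'rV[R]_d) (r : R) :
  coupling mu nu pi -> 0 < r ->
  measurable (F : set X) -> measurable (O : set X) ->
  (forall x y, F x -> ~ O y -> ~ ball y r x) ->
  ((r ^+ 2)%:E * val mu F <= (r ^+ 2)%:E * val nu O + cost pi)%E.
Proof.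
move=> cpi r0 mF mO FO.
have [muF _] := cpi _ mF; have [_ nuO] := cpi _ mO.
have mlF : measurable (lsubmx @^-1` F : set (borel_rV R (d + d))).
  by rewrite -[X in measurable X]setTI; exact: (@measurable_lsubmx R d d).
have mrO : measurable (rsubmx @^-1` O : set (borel_rV R (d + d))).
  by rewrite -[X in measurable X]setTI; exact: (@measurable_rsubmx R d d).
have r20 : 0 <= r ^+ 2 by exact: sqr_ge0.
have mi S : measurable S -> measurable_fun setT
    (fun z : borel_rV R (d + d) => ((r ^+ 2)%:E * (\1_S z)%:E)%E).
  by move=> mS; apply/measurable_EFinP; exact: measurable_funM.
have iE S : measurable S ->
    (\int[pi]_z ((r ^+ 2)%:E * (\1_S z)%:E) = (r ^+ 2)%:E * pi S)%E.
  move=> mS; rewrite ge0_integralZl ?lee_fin//; last exact/measurable_EFinP.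
  by rewrite integral_indic// setIT.
have i0 S z : (0 <= (r ^+ 2)%:E * (\1_S z)%:E :> \bar R)%E.
  by rewrite -EFinM lee_fin mulr_ge0.
have c0 z : (0 <= (sqnorm (lsubmx (z : 'rV[R]_(d + d)) - rsubmx z))%:E)%E.
  by rewrite lee_fin sqnorm_ge0.
have mc := @measurable_cost_fun R d.
have miO := mi _ mrO; have miF := mi _ mlF.
rewrite -muF -nuO -!iE// /cost -ge0_integralD//.
apply: ge0_le_integral => //; first exact: emeasurable_funD.
move=> z _; rewrite -!EFinM -EFinD lee_fin !indicE.
have {}c0 := sqnorm_ge0 (lsubmx (z : 'rV[R]_(d + d)) - rsubmx z).
have [/set_mem/= Fz|_] := boolP (z \in _); last first.
  by rewrite mulr0 addr_ge0// mulr_ge0.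
have [|/negP nOz] := boolP (z \in _).
  by rewrite mulr1 lerDl.
rewrite mulr1 mulr0 add0r.
have nO : ~ O (rsubmx z) by move=> Oz; apply: nOz; exact: mem_set.
have := FO _ _ Fz nO; apply: contra_notP => /negP; rewrite -ltNge => cr.
split=> // i j; rewrite (ord1 i) /ball/= -ltr_sqr ?nnegrE//; last exact: ltW.
rewrite -normrX ger0_norm ?sqr_ge0//; apply: le_lt_trans cr.
by have := sqr_coord_le_sqnorm (lsubmx z - rsubmx z) j; rewrite !mxE -sqrrN opprB.
Qed.

Lemma W2_open_mass (O : set 'rV[R]_d) (t : R) : open O ->
  W2_open [set mu : P2 R d | (t%:E < val mu O)%E].
Proof.
move=> oO mu /= tmu; have mO : measurable (O : set X) by exact: open_measurable_rV.
pose s := fine (val mu O); have sE : val mu O = s%:E.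
  by rewrite fineK// fin_num_measure.
have ts : t < s by rewrite -lte_fin -sE.
(* Half of the margin s - t pays for eroding O to F, the other half for the
   mass leaving F; the latter is bounded by the cost over r^2, whence the
   radius r * sqrt e of the ball below. *)
pose e := (s - t) / 2; have e0 : 0 < e by rewrite divr_gt0// subr_gt0.
have [F [r [cF r0 FsubO muOF FO]]] := erosion (val mu) oO e0.
have mF : measurable (F : set X) by exact: closed_measurable_rV.
exists (r * Num.sqrt e); first by rewrite mulr_gt0// sqrtr_gt0.
move=> nu /= W2e.
have : (W2sq mu nu < (r ^+ 2 * e)%:E)%E.
  have re0 : 0 <= r ^+ 2 * e by rewrite mulr_ge0 ?sqr_ge0// ltW.
  rewrite ltNge -lee_sqrt ?W2sq_ge0//.
  rewrite /= sqrtrM ?sqr_ge0// sqrtr_sqr gtr0_norm// -ltNge.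
  exact: W2e.
move=> /ereal_inf_lt[_ [pi cpi <-] costpi].
have H := coupling_mass_le cpi r0 mF mO FO.
have muF : (val mu F = (fine (val mu F))%:E) by rewrite fineK// fin_num_measure.
have nuO : (val nu O = (fine (val nu O))%:E) by rewrite fineK// fin_num_measure.
have muO : (val mu O <= val mu F + val mu (O `\` F))%E.
  rewrite -{1}(setDUK FsubO); apply: measureU2 => //; exact: measurableD.
have mOF : measurable (O `\` F : set X) by exact: measurableD.
have OFE : (val mu (O `\` F) = (fine (val mu (O `\` F)))%:E).
  by rewrite fineK// fin_num_measure.
rewrite nuO lte_fin; rewrite muF nuO in H; rewrite sE muF OFE in muO.
rewrite OFE lte_fin in muOF; rewrite -EFinD lee_fin in muO.
have {}H : (r ^+ 2 * fine (val mu F) < r ^+ 2 * fine (val nu O) + r ^+ 2 * e).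
  rewrite -lte_fin !EFinD !EFinM; apply: le_lt_trans H _.
  by rewrite -!EFinM lteD2lE.
rewrite -mulrDr ltr_pM2l ?exprn_gt0// in H.
rewrite /e in H muOF; lra.
Qed.

(** The Borel sets A for which the conclusion holds form a lambda-system that
    contains the open sets. *)
Lemma measurable_mass (A : set X) : measurable A ->
  measurable_fun [set: P2 R d] (fun mu : P2 R d => val mu A).
Proof.
pose H := [set A : set X | measurable A /\
  measurable_fun [set: P2 R d] (fun mu : P2 R d => val mu A)].
suff : @measurable _ X `<=` H by move=> sub /sub[].
apply: lambda_system_subset => //.
- by move=> U V oU oV; exact: openI.
- split => //.
  + split => //; apply: (eq_measurable_fun (cst 1%E)) => //.
    by move=> mu _; rewrite probability_setT.
  + move=> U V VU [mU mfU] [mV mfV]; split; first exact: measurableD.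
    apply: (eq_measurable_fun (fun mu : P2 R d => val mu U - val mu V)%E).
      move=> mu _; rewrite measureD// ?(setIidr VU)//.
      by rewrite (le_lt_trans (probability_le1 _ _)) ?ltry.
    exact: emeasurable_funB.
  + move=> F ndF HF; have mF k : measurable (F k) by have [] := HF k.
    have mUF : measurable (\bigcup_k F k) by exact: bigcupT_measurable.
    split => //.
    apply: (emeasurable_fun_cvg (fun k (mu : P2 R d) => val mu (F k))).
      by move=> k; have [] := HF k.
    by move=> mu _; exact: nondecreasing_cvg_mu.
- move=> U oU; split; first exact: open_measurable_rV.
  apply: (measurability _ (ErealGenOInfty.measurableE R)).
  move=> _ [_ [t ->] <-]; rewrite setTI preimage_itvoy.
  apply: sub_sigma_algebra; exact: W2_open_mass.
Qed.

Lemma measurable_cell_mass_fst N (i : N.-tuple bool) :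
  measurable_fun [set: P2 R d * P2 R d]
    (fun w : P2 R d * P2 R d => cell_mass (val w.1) i).
Proof.
apply: (measurableT_comp (f := fun mu : P2 R d => cell_mass (val mu) i)) => //.
apply: (measurableT_comp (f := @fine R)) => //.
by apply: measurable_mass; exact: measurable_code.
Qed.

Lemma measurable_cell_mass_snd N (i : N.-tuple bool) :
  measurable_fun [set: P2 R d * P2 R d]
    (fun w : P2 R d * P2 R d => cell_mass (val w.2) i).
Proof.
apply: (measurableT_comp (f := fun mu : P2 R d => cell_mass (val mu) i)) => //.
apply: (measurableT_comp (f := @fine R)) => //.
by apply: measurable_mass; exact: measurable_code.
Qed.

Lemma measurable_approx_plan N (p : N.-tuple bool * N.-tuple bool -> R) :
  measurable [set w : P2 R d * P2 R d | approx_plan (val w.1) (val w.2) p].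
Proof.
rewrite (_ : [set _ | _] = [set w : P2 R d * P2 R d | (forall ij, 0 <= p ij) /\
  ((forall i, cell_mass (val w.1) i <= \sum_j p (i, j) /\
     \sum_j p (i, j) <= (1 + N.+1%:R^-1) * cell_mass (val w.1) i) /\
   (forall j, cell_mass (val w.2) j <= \sum_i p (i, j) /\
     \sum_i p (i, j) <= (1 + N.+1%:R^-1) * cell_mass (val w.2) j))]).
  apply: measurable_and; first exact: measurable_const_prop.
  apply: measurable_and; apply: measurable_forall => i; apply: measurable_and;
    apply: measurable_le_fun => //; try apply: measurable_funM => //;
    by [exact: measurable_cell_mass_fst|exact: measurable_cell_mass_snd].
apply/seteqP; split=> w.
  by move=> [p0 p1 p2]; split=> //; split=> i; [apply/andP; exact: p1|apply/andP; exact: p2].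
by move=> [p0 [p1 p2]]; split=> // i; apply/andP; [exact: p1|exact: p2].
Qed.

(** The slack 1/(N+1) added to r leaves room for the infimum defining [W2sq]
    not to be known to be attained; the factor is the rounding error of
    [plan_approx]. *)
Definition cheap_plan (r : R) (w : P2 R d * P2 R d) N
    (p : {ffun N.-tuple bool * N.-tuple bool -> rat}) : Prop :=
  approx_plan (val w.1) (val w.2) (fun ij => ratr (p ij)) /\
  \sum_ij cell_cost (@quad_cost R d) ij * ratr (p ij) <=
    (1 + N.+1%:R^-1) * (r + N.+1%:R^-1).

Lemma cvg_slack (r : R) :
  (1 + N.+1%:R^-1) * (r + N.+1%:R^-1) @[N --> \oo] --> r.
Proof.
have h : N.+1%:R^-1 @[N --> \oo] --> (0 : R) by exact: cvg_harmonic.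
rewrite -[X in _ --> X]mul1r; apply: cvgM.
  by rewrite -[X in _ --> X]addr0; apply: cvgD => //; exact: cvg_cst.
by rewrite -[X in _ --> X]addr0; apply: cvgD => //; exact: cvg_cst.
Qed.

(** Direct part: pick a plan of cost below r + 1/(N+1), depending on N.
    Converse: [plan_limit], where mass at least 0 is asked of an arbitrary
    rectangle. *)
Lemma W2sq_leP (r : R) (w : P2 R d * P2 R d) :
  (W2sq w.1 w.2 <= r%:E)%E <-> forall N, exists p, @cheap_plan r w N p.
Proof.
split=> [Wr N|H].
  have : (W2sq w.1 w.2 < (r + N.+1%:R^-1)%:E)%E.
    by apply: le_lt_trans Wr _; rewrite lte_fin ltrDl invr_gt0.
  move=> /ereal_inf_lt[_ [pi cpi <-] /ltW cr].
  have [pi' [[p1 p2] pic _]] := coupling_split cpi.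
  rewrite -pic in cr.
  have [p [ap cp _]] := plan_approx (@quad_cost_ge0 R d) (@quad_cost_lsc R d) N p1 p2 cr
    (measure_ge0 pi' (rV_base 0 `*` rV_base 0)).
  by exists p.
have [pi [p1 p2 pic _]] := @plan_limit R d d (@quad_cost R d) (@quad_cost_ge0 R d)
  (@quad_cost_lsc R d) (val w.1) (val w.2) 0 0 0 r _
  (fun N ij => ratr (projT1 (cid (H N)) ij)) (@cvg_slack r) (fun N =>
  let h := projT2 (cid (H N)) in And3 h.1 h.2
    (sumr_ge0 _ (fun ij _ => let: And3 h0 _ _ := h.1 in h0 ij))).
have [pi' [cpi' cE _]] := coupling_join (conj p1 p2).
apply: le_trans pic; rewrite -cE; apply: ereal_inf_lbound.
by exists pi'.
Qed.

Lemma measurable_W2sq : measurable_fun [set: P2 R d * P2 R d]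
  (fun w : P2 R d * P2 R d => W2sq w.1 w.2).
Proof.
apply: (measurability _ (ErealGenOInfty.measurableE R)).
move=> _ [_ [r ->] <-]; rewrite setTI preimage_itvoy.
rewrite (_ : [set _ | _] = ~` [set w : P2 R d * P2 R d |
    forall N, exists p, @cheap_plan r w N p]).
  apply: measurableC; apply: measurable_forall => N; apply: measurable_exists => p.
  apply: measurable_and; first exact: measurable_approx_plan.
  exact: measurable_const_prop.
apply/seteqP; split=> w /=.
  by move=> rW /W2sq_leP; rewrite leNgt rW.
by move=> nH; rewrite ltNge; apply/negP => /W2sq_leP.
Qed.

(** The condition of [W2sq_leP] at the optimal cost, together with mass a on
    a basic rectangle. *)
Definition optimal_charging k l (a : R) (w : P2 R d * P2 R d) : Prop :=
  forall N, exists p : {ffun N.-tuple bool * N.-tuple bool -> rat},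
    cheap_plan (fine (W2sq w.1 w.2)) w p /\
    a <= \sum_(ij | base_cells k l ij) ratr (p ij).

Lemma measurable_optimal_charging k l a : measurable [set w | optimal_charging k l a w].
Proof.
apply: measurable_forall => N; apply: measurable_exists => p.
apply: measurable_and; last exact: measurable_const_prop.
apply: measurable_and; first exact: measurable_approx_plan.
apply: measurable_le_fun => //; apply: measurable_funM => //.
apply: measurable_funD => //.
apply: (measurableT_comp (f := @fine R)) => //.
exact: measurable_W2sq.
Qed.

(** Since [fine] reads an infinite optimal cost as 0, finiteness matters in
    both directions: a plan produced by [plan_limit] has finite cost, which
    bounds the optimal one, and a given optimal plan has finite cost by
    [coupling_cost_fin]. *)
Lemma optimal_chargingP k l a w : optimal_charging k l a w <->
  exists2 pi, optimal_plans w.1 w.2 pi &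
    (a%:E <= pi (@split_rV R d d @^-1` (rV_base k `*` rV_base l)))%E.
Proof.
split=> [H|[pi [cpi cE] pia] N].
  have [pi [p1 p2 pic pia]] := @plan_limit R d d (@quad_cost R d) (@quad_cost_ge0 R d)
    (@quad_cost_lsc R d) (val w.1) (val w.2) k l a (fine (W2sq w.1 w.2)) _
    (fun N ij => ratr (projT1 (cid (H N)) ij)) (@cvg_slack _) (fun N =>
    let h := projT2 (cid (H N)) in And3 h.1.1 h.1.2 h.2).
  have [pi' [cpi' cE pi'E]] := coupling_join (conj p1 p2).
  exists pi'; last first.
    rewrite pi'E; apply: le_trans pia _; rewrite -comp_preimage.
    rewrite (_ : @split_rV R d d \o @join_rV R d d = id) ?preimage_id//.
    by apply/funext => z; exact: join_rVK.
  rewrite -cE in pic.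
  have Wc : (W2sq w.1 w.2 <= cost pi')%E by apply: ereal_inf_lbound; exists pi'.
  split=> //; apply/eqP; rewrite eq_le Wc andbT; apply: (le_trans pic).
  rewrite fineK// ge0_fin_numE ?W2sq_ge0//.
  by apply: (le_lt_trans (le_trans Wc pic)); rewrite ltry.
have [pi' [[p1 p2] pic piE]] := coupling_split cpi.
have Wfin : W2sq w.1 w.2 = (fine (W2sq w.1 w.2))%:E.
  by rewrite fineK// ge0_fin_numE ?W2sq_ge0// -cE; exact: (coupling_cost_fin cpi).
have cr : (\int[pi']_z (quad_cost z)%:E <= (fine (W2sq w.1 w.2))%:E)%E.
  by rewrite pic cE -Wfin.
rewrite -piE in pia.
have [p [ap cp pa]] := plan_approx (@quad_cost_ge0 R d) (@quad_cost_lsc R d) N p1 p2 cr pia.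
exists p; split=> //; split=> //; apply: le_trans cp _.
by rewrite ler_wpM2l ?addr_ge0// lerDl.
Qed.

Lemma svpreimage_Psi (U : set 'rV[R]_(d + d)) : open U ->
  svpreimage (@Psi R d) U = \bigcup_(klm in [set klm : nat * nat * nat |
    rV_base klm.1.1 `*` rV_base klm.1.2 `<=` @join_rV R d d @^-1` U])
  [set w | optimal_charging klm.1.1 klm.1.2 klm.2.+1%:R^-1 w].
Proof.
move=> oU; apply/seteqP; split=> w.
  move=> [z [[pi opi sz] Uz]].
  have [[k l] /= [zkl klU]] : exists kl : nat * nat,
      (rV_base kl.1 `*` rV_base kl.2) (split_rV z) /\
      rV_base kl.1 `*` rV_base kl.2 `<=` @join_rV R d d @^-1` U.
    by apply: rect_baseP => //; rewrite split_rVK.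
  have oW : open (@split_rV R d d @^-1` (rV_base k `*` rV_base l)).
    apply: openI; [apply: open_lsubmx|apply: open_rsubmx]; exact: rV_base_open.
  have piW : (0 < pi (@split_rV R d d @^-1` (rV_base k `*` rV_base l)))%E.
    by apply: sz.
  have Wfin : pi (@split_rV R d d @^-1` (rV_base k `*` rV_base l)) \is a fin_num.
    by apply: fin_num_measure; exact: open_measurable_rV.
  have f0 : 0 < fine (pi (@split_rV R d d @^-1` (rV_base k `*` rV_base l))).
    by rewrite -lte_fin fineK.
  have [m _ /(_ m (leqnn m)) /= mW] := near_infty_natSinv_lt (PosNum f0).
  exists (k, l, m) => //=; apply/optimal_chargingP; exists pi => //.
  by rewrite -(fineK Wfin) lee_fin ltW.
move=> [[[k l] m] /= klU /optimal_chargingP[pi opi pim]].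
have oW : open (@split_rV R d d @^-1` (rV_base k `*` rV_base l)).
  apply: openI; [apply: open_lsubmx|apply: open_rsubmx]; exact: rV_base_open.
have [|z Wz sz] := supp_meets oW (pi := pi).
  by apply: lt_le_trans pim; rewrite lte_fin invr_gt0.
exists z; split; first by exists pi.
by have := klU _ Wz; rewrite /= split_rVK.
Qed.

End wasserstein_borel.

Theorem theorem1p3 (R : realType) (d : nat) :
  svmeasurable (@Psi R d).
Proof.
move=> U oU; rewrite svpreimage_Psi//.
apply: countable_bigcup_measurable; first exact: countableP.
by move=> klm _; exact: measurable_optimal_charging.
Qed.
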